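(* (Rigidity property of the Weil algebra.) Let $\mathcal{A}$ be a locally free $\mathfrak{g}$-differential algebra. Any two homomorphisms of $\mathfrak{g}$-differential spaces $c_0,c_1:W\mathfrak{g}\to\mathcal{A}$ that agree on the unit of $W\mathfrak{g}$ are $\mathfrak{g}$-homotopic.
   Context: $\mathbb{F}$ is a field of characteristic $0$, $\mathfrak{g}$ a finite-dimensional Lie algebra over $\mathbb{F}$. ''Super'' means $\mathbb{Z}_2$-graded with the usual sign rule; super algebras are associative and unital (not necessarily commutative); $[\cdot,\cdot]$ denotes super commutators of operators. A $\mathfrak{g}$-differential space is a super vector space $E$ with an odd operator $d$, $d^2=0$, and, depending linearly on $\xi\in\mathfrak{g}$, odd operators $\iota_\xi$ and even operators $L_\xi$ such that $[\iota_\xi,\iota_\zeta]=0$, $[L_\xi,\iota_\zeta]=\iota_{[\xi,\zeta]}$, $[L_\xi,L_\zeta]=L_{[\xi,\zeta]}$, $[d,\iota_\xi]=L_\xi$, $[d,L_\xi]=0$. Homomorphisms of $\mathfrak{g}$-differential spaces are even linear maps commuting with $d,\iota_\xi,L_\xi$. Two such homomorphisms $\phi_0,\phi_1:E\to E'$ are $\mathfrak{g}$-homotopic if there is an odd linear map $h:E\to E'$ with $dh+hd=\phi_0-\phi_1$, $\iota_\xi h+h\iota_\xi=0$ and $L_\xi h=hL_\xi$ for all $\xi$. A $\mathfrak{g}$-differential algebra is a super algebra that is a $\mathfrak{g}$-differential space for which $d,\iota_\xi,L_\xi$ are super derivations. For $\mu\in\mathfrak{g}^*$ let $(\mathrm{ad}_\xi^*\mu)(\zeta)=\mu([\xi,\zeta])$.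 A connection on $\mathcal{A}$ is a linear map $\theta:\mathfrak{g}^*\to\mathcal{A}^{\bar 1}$ (odd part) with $\iota_\xi\theta(\mu)=\mu(\xi)1$ and $L_\xi\theta(\mu)=-\theta(\mathrm{ad}^*_\xi\mu)$; $\mathcal{A}$ is locally free if it admits a connection. The Weil algebra $W\mathfrak{g}$ is the free super-commutative algebra generated by odd elements $\mu$ and even elements $\overline{\mu}$ (linear in $\mu\in\mathfrak{g}^*$), with derivations determined by $d\mu=\overline\mu$, $d\overline\mu=0$, $L_\xi\mu=-\mathrm{ad}_\xi^*\mu$, $L_\xi\overline\mu=-\overline{\mathrm{ad}_\xi^*\mu}$, $\iota_\xi\mu=\mu(\xi)$, $\iota_\xi\overline\mu=-\mathrm{ad}_\xi^*\mu$. *)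

(* Defs.v *)
From HB Require Import structures.
From mathcomp Require Import all_boot all_order all_algebra.

Set Implicit Arguments.
Unset Strict Implicit.
Unset Printing Implicit Defensive.

Import GRing.Theory.
Local Open Scope ring_scope.

HB.mixin Record Vector_isLieAlgebra (F : fieldType) g of Vector F g := {
  lie : {bilinear g -> g -> g};
  liexx : forall x : g, lie x x = 0;
  lie_jacobi : forall x y z : g,
    lie x (lie y z) + lie y (lie z x) + lie z (lie x y) = 0
}.

#[short(type="lieAlgType")]
HB.structure Definition LieAlgebra (F : fieldType) :=
  {g of Vector F g & Vector_isLieAlgebra F g}.

(* Parities are booleans: [false] is even, [true] is odd, and they add by
   [addb].  [homog p] is the homogeneous summand of parity [p]. *)
HB.mixin Record Lmodule_isSuper (F : fieldType) E of GRing.Lmodule F E := {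
  homog : bool -> E -> Prop;
  homog0 : forall p, homog p 0;
  homogP : forall p (a : F) x y,
    homog p x -> homog p y -> homog p (a *: x + y);
  homog_decomp : forall x, exists x0 x1,
    [/\ homog false x0, homog true x1 & x = x0 + x1];
  homog_indep : forall x, homog false x -> homog true x -> x = 0
}.

#[short(type="superSpaceType")]
HB.structure Definition SuperSpace (F : fieldType) :=
  {E of GRing.Lmodule F E & Lmodule_isSuper F E}.

Definition has_parity (F : fieldType) (E E' : superSpaceType F) (p : bool)
    (f : E -> E') : Prop :=
  forall q x, homog q x -> homog (p (+) q) (f x).

Definition super_comm (F : fieldType) (E : lmodType F) (p q : bool)
    (f g : E -> E) (x : E) : E :=
  f (g x) - (-1) ^+ (p && q) *: g (f x).

HB.mixin Record SuperSpace_isGDSpace (F : fieldType) (g : lieAlgType F) E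
    of SuperSpace F E := {
  gd_d : {linear E -> E};
  gd_iota : {bilinear g -> E -> E};
  gd_L : {bilinear g -> E -> E};
  gd_d_odd : has_parity true gd_d;
  gd_iota_odd : forall xi, has_parity true (gd_iota xi);
  gd_L_even : forall xi, has_parity false (gd_L xi);
  gd_dd : forall x, gd_d (gd_d x) = 0;
  gd_iota_iota : forall xi zeta x,
    super_comm true true (gd_iota xi) (gd_iota zeta) x = 0;
  gd_L_iota : forall xi zeta x,
    super_comm false true (gd_L xi) (gd_iota zeta) x = gd_iota (lie xi zeta) x;
  gd_L_L : forall xi zeta x,
    super_comm false false (gd_L xi) (gd_L zeta) x = gd_L (lie xi zeta) x;
  gd_d_iota : forall xi x,
    super_comm true true gd_d (gd_iota xi) x = gd_L xi x;
  gd_d_L : forall xi x, super_comm true false gd_d (gd_L xi) x = 0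
}.

#[short(type="gdSpaceType")]
HB.structure Definition GDSpace (F : fieldType) (g : lieAlgType F) :=
  {E of SuperSpace F E & SuperSpace_isGDSpace F g E}.

(* The product of a super algebra is the [monoidType] one, written [(x * y)%g]
   with unit [1%g].  [algType] would exclude the zero algebra, and [lmodType]
   cannot be joined with [pzRingType] below it. *)
HB.mixin Record SuperSpace_isSuperAlgebra (F : fieldType) A
    of SuperSpace F A & Monoid A := {
  super_mulPl : forall (a : F) (x y z : A),
    ((a *: x + y)%R * z)%g = a *: (x * z)%g + (y * z)%g;
  super_mulPr : forall (a : F) (x y z : A),
    (z * (a *: x + y)%R)%g = a *: (z * x)%g + (z * y)%g;
  homog1 : homog false (1%g : A);
  homogM : forall p q (x y : A),
    homog p x -> homog q y -> homog (p (+) q) (x * y)%g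
}.

#[short(type="superAlgType")]
HB.structure Definition SuperAlgebra (F : fieldType) :=
  {A of SuperSpace F A & Monoid A & SuperSpace_isSuperAlgebra F A}.

Definition super_derivation (F : fieldType) (A : superAlgType F) (p : bool)
    (D : A -> A) : Prop :=
  forall q x y, homog q x ->
    D (x * y)%g = (D x * y)%g + (-1) ^+ (p && q) *: (x * D y)%g.

HB.mixin Record GDSpace_isGDAlgebra (F : fieldType) (g : lieAlgType F) A
    of SuperAlgebra F A & GDSpace F g A := {
  gd_d_der : super_derivation true (gd_d : A -> A);
  gd_iota_der : forall xi : g, super_derivation true (gd_iota xi : A -> A);
  gd_L_der : forall xi : g, super_derivation false (gd_L xi : A -> A)
}.

#[short(type="gdAlgType")]
HB.structure Definition GDAlgebra (F : fieldType) (g : lieAlgType F) :=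
  {A of SuperAlgebra F A & GDSpace F g A & GDSpace_isGDAlgebra F g A}.

Definition gd_hom (F : fieldType) (g : lieAlgType F) (E E' : gdSpaceType g)
    (c : {linear E -> E'}) : Prop :=
  [/\ has_parity false c,
      forall x, c (gd_d x) = gd_d (c x),
      forall xi x, c (gd_iota xi x) = gd_iota xi (c x)
    & forall xi x, c (gd_L xi x) = gd_L xi (c x)].

Definition gd_homotopic (F : fieldType) (g : lieAlgType F)
    (E E' : gdSpaceType g) (c0 c1 : {linear E -> E'}) : Prop :=
  exists h : {linear E -> E'},
  [/\ has_parity true h,
      forall x, gd_d (h x) + h (gd_d x) = c0 x - c1 x,
      forall xi x, gd_iota xi (h x) + h (gd_iota xi x) = 0
    & forall xi x, gd_L xi (h x) = h (gd_L xi x)].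

Definition ad_star (F : fieldType) (g : lieAlgType F) (xi : g)
    (mu : 'Hom(g, F^o)) : 'Hom(g, F^o) :=
  (mu \o linfun (lie xi))%VF.

Lemma ad_starE (F : fieldType) (g : lieAlgType F) (xi zeta : g)
    (mu : 'Hom(g, F^o)) :
  ad_star xi mu zeta = mu (lie xi zeta).
Proof. by rewrite comp_lfunE lfunE. Qed.

Definition connection (F : fieldType) (g : lieAlgType F) (A : gdAlgType g)
    (theta : {linear 'Hom(g, F^o) -> A}) : Prop :=
  [/\ forall mu, homog true (theta mu),
      forall xi mu, gd_iota xi (theta mu) = (mu xi : F) *: 1%g
    & forall xi mu, gd_L xi (theta mu) = - theta (ad_star xi mu)].

Definition locally_free (F : fieldType) (g : lieAlgType F)
    (A : gdAlgType g) : Prop :=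
  exists theta : {linear 'Hom(g, F^o) -> A}, connection theta.

Definition super_commutative (F : fieldType) (A : superAlgType F) : Prop :=
  forall p q (x y : A), homog p x -> homog q y ->
    (x * y)%g = (-1) ^+ (p && q) *: (y * x)%g.

Definition super_alg_hom (F : fieldType) (A B : superAlgType F)
    (f : {linear A -> B}) : Prop :=
  [/\ has_parity false f, f 1%g = 1%g & {morph f : x y / (x * y)%g}].

(* [W] is the free super-commutative algebra on odd generators [s v] and even
   generators [t v], depending linearly on [v : V]. *)
Definition free_super_commutative (F : fieldType) (V : lmodType F)
    (W : superAlgType F) (s t : {linear V -> W}) : Prop :=
  [/\ super_commutative W,
      forall v, homog true (s v),
      forall v, homog false (t v)
    & forall (B : superAlgType F) (s' t' : {linear V -> B}),
        super_commutative B ->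
        (forall v, homog true (s' v)) -> (forall v, homog false (t' v)) ->
        exists f : {linear W -> B},
          [/\ super_alg_hom f, f \o s =1 s', f \o t =1 t'
            & forall f' : {linear W -> B},
                super_alg_hom f' -> f' \o s =1 s' -> f' \o t =1 t' ->
                f' =1 f]].

(* [s mu] is the odd generator $\mu$ and [t mu] the even generator
   $\overline\mu$. *)
Definition weil_algebra (F : fieldType) (g : lieAlgType F)
    (W : gdAlgType g) : Prop :=
  exists s t : {linear 'Hom(g, F^o) -> W},
  [/\ free_super_commutative s t,
      (forall mu, gd_d (s mu) = t mu) /\ (forall mu, gd_d (t mu) = 0),
      (forall xi mu, gd_L xi (s mu) = - s (ad_star xi mu)) /\
      (forall xi mu, gd_L xi (t mu) = - t (ad_star xi mu))
    & (forall xi mu, gd_iota xi (s mu) = (mu xi : F) *: 1%g) /\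
      (forall xi mu, gd_iota xi (t mu) = - s (ad_star xi mu))].

(* Main.v *)
(* Let f = c0 - c1, a morphism of g-differential spaces that kills the unit.
   The Koszul derivation K of W (t mu |-> s mu, s mu |-> 0) satisfies
   d K + K d = N, the number of generators, so f o K N^-1 would be a homotopy,
   were it horizontal; but K only anticommutes with the part iota0 of iota that
   preserves N, and iota - iota0 is the partial derivative in the odd
   generators.  The connection repairs this: the contraction
     (Th u)(w) = sum_j +- theta(e_j) u(d w / d(s e_j))
                       + d(theta e_j) u(d w / d(t e_j))
   is locally nilpotent, commutes with d and L, and its commutator with iota is
   exactly composition with that partial derivative.  Hence conjugation by
   exp Th exchanges iota and iota0 on linear maps W -> A, and
     h = exp(Th) ((exp(-Th) f) o K N^-1)
   is the required homotopy. *)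
Require Import Defs.
From HB Require Import structures.
From mathcomp Require Import all_boot all_order all_algebra.
From mathcomp Require Import boolp.

Set Implicit Arguments.
Unset Strict Implicit.
Unset Printing Implicit Defensive.

Import GRing.Theory.
Local Open Scope ring_scope.

(** [W] is known only through its universal property, so there is no monomial basis in which to
    write down K, N or the partial derivatives. That property produces algebra homomorphisms rather
    than derivations, which is why K is extracted from a homomorphism into odd dual numbers. Every
    further derivation is a super commutator: [d, K] counts generators, [K, iota] is the even
    partial derivative, and the commutator of the latter with d is the odd one. Their relations then
    need checking on generators only.

    In [A] the values of theta obey no commutation rule in general, and c0, c1 are merely linear.
    Hence theta acts by left multiplication only and is packed into the single operator Th, so that
    the exponential is a series in one variable.

    Characteristic 0 separates the eigenvalues of N, inverts N in positive degree, and gives sense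
    to 1/a!. In degree 0, where N vanishes, only multiples of the unit remain, and f kills them. *)

Lemma sum_widen (V : zmodType) n m (v : nat -> V) :
  (n <= m)%N -> \sum_(k < n) v k = \sum_(k < m) (if (k < n)%N then v k else 0).
Proof.
move=> nm; rewrite (big_ord_widen m v nm) big_mkcond /=.
by apply: eq_bigr => i _.
Qed.

Lemma sum_trunc (V : zmodType) m n (v : nat -> V) : (m <= n)%N ->
  (forall a, (m <= a)%N -> v a = 0) -> \sum_(a < n) v a = \sum_(a < m) v a.
Proof.
move=> mn v0; rewrite (sum_widen v mn); apply: eq_bigr => i _.
by case: ltnP => // /v0.
Qed.

(** * Super spaces and super algebras *)

Section SuperSpaces.
Variables (F : fieldType) (E : superSpaceType F).
Implicit Types (x y : E) (p q : bool).

Lemma homogD p x y : homog p x -> homog p y -> homog p (x + y).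
Proof. by move=> hx hy; rewrite -[x]scale1r; apply: homogP. Qed.

Lemma homogZ p (a : F) x : homog p x -> homog p (a *: x).
Proof.
by move=> hx; rewrite -[a *: x]addr0; apply: homogP => //; apply: homog0.
Qed.

Lemma homogN p x : homog p x -> homog p (- x).
Proof. by rewrite -scaleN1r; apply: homogZ. Qed.

Lemma homogB p x y : homog p x -> homog p y -> homog p (x - y).
Proof. by move=> hx hy; apply/homogD/homogN. Qed.

Lemma homog_sum p n (v : nat -> E) :
  (forall i, homog p (v i)) -> homog p (\sum_(i < n) v i).
Proof.
by move=> hv; apply: big_ind => //; [exact: homog0 | exact: homogD].
Qed.

Lemma homog_split x y z t :
  homog false x -> homog true y -> homog false z -> homog true t ->
  x + y = z + t -> x = z /\ y = t.
Proof.
move=> hx hy hz ht e.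
have e' : x - z = t - y.
  by apply/eqP; rewrite subr_eq addrAC eq_sym subr_eq addrC -e addrC.
have d0 : x - z = 0.
  by apply: homog_indep; [|rewrite e']; apply: homogB.
split; first exact/subr0_eq.
by apply/esym/subr0_eq; rewrite -e'.
Qed.

(** The grading involution: it provides the sign $(-1)^q$ on elements that are not homogeneous.
    Since [homog_decomp] only asserts existence, the components are chosen by [cid]; [parity_opE]
    shows that the choice is immaterial. *)
Definition parity_op x : E :=
  let: exist x0 H := cid (homog_decomp x) in x0 - projT1 (cid H).

Lemma parity_opE x0 x1 :
  homog false x0 -> homog true x1 -> parity_op (x0 + x1) = x0 - x1.
Proof.
move=> h0 h1; rewrite /parity_op; case: cid => y0 H /=.
case: (cid H) => y1 /= [k0 k1 e].
by have [-> ->] := homog_split h0 h1 k0 k1 e.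
Qed.

Lemma parity_op_homog p x : homog p x -> parity_op x = (-1) ^+ p *: x.
Proof.
case: p => h.
  by rewrite -[in LHS](add0r x) parity_opE // ?sub0r ?scaleN1r //; apply: homog0.
rewrite -[in LHS](addr0 x) parity_opE // ?subr0 ?scale1r //; exact: homog0.
Qed.

Lemma parity_op_linear : linear parity_op.
Proof.
move=> a x y.
have [x0 [x1 [h0 h1 ->]]] := homog_decomp x.
have [y0 [y1 [k0 k1 ->]]] := homog_decomp y.
rewrite scalerDr addrACA !parity_opE //; try exact: homogP.
by rewrite scalerBr opprD addrACA.
Qed.

HB.instance Definition _ :=
  GRing.isLinear.Build F E E _ parity_op parity_op_linear.

Lemma homog_parity_op p x : homog p x -> homog p (parity_op x).
Proof. by move=> h; rewrite (parity_op_homog h); apply: homogZ. Qed.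

End SuperSpaces.

Section SuperAlgebras.
Variables (F : fieldType) (A : superAlgType F).
Implicit Types x y z : A.

Lemma smulDl x y z : ((x + y)%R * z)%g = (x * z)%g + (y * z)%g.
Proof. by have := super_mulPl 1 x y z; rewrite !scale1r. Qed.

Lemma smulDr x y z : (z * (x + y)%R)%g = (z * x)%g + (z * y)%g.
Proof. by have := super_mulPr 1 x y z; rewrite !scale1r. Qed.

Lemma smul0l x : ((0%R : A) * x)%g = 0.
Proof. by apply: (addIr ((0%R : A) * x)%g); rewrite -smulDl !add0r. Qed.

Lemma smul0r x : (x * (0%R : A))%g = 0.
Proof. by apply: (addIr (x * (0%R : A))%g); rewrite -smulDr !add0r. Qed.

Lemma smulZl (a : F) x y : ((a *: x)%R * y)%g = a *: (x * y)%g.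
Proof. by rewrite -[(a *: x)%R]addr0 super_mulPl smul0l addr0. Qed.

Lemma smulZr (a : F) x y : (x * (a *: y)%R)%g = a *: (x * y)%g.
Proof. by rewrite -[(a *: y)%R]addr0 super_mulPr smul0r addr0. Qed.

Lemma smulNl x y : ((- x)%R * y)%g = - (x * y)%g.
Proof. by rewrite -scaleN1r smulZl scaleN1r. Qed.

Lemma smulNr x y : (x * (- y)%R)%g = - (x * y)%g.
Proof. by rewrite -(scaleN1r y) smulZr scaleN1r. Qed.

Lemma smul_sumr I (r : seq I) (P : pred I) (v : I -> A) y :
  (y * (\sum_(i <- r | P i) v i)%R)%g = \sum_(i <- r | P i) (y * v i)%g.
Proof.
by apply: (big_morph (fun x => (y * x)%g)) => [u w|]; rewrite ?smulDr ?smul0r.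
Qed.

Lemma parity_opM x y : parity_op (x * y)%g = (parity_op x * parity_op y)%g.
Proof.
have [x0 [x1 [h0 h1 ->]]] := homog_decomp x.
have [y0 [y1 [k0 k1 ->]]] := homog_decomp y.
rewrite !smulDl !smulDr !raddfD /=.
rewrite (parity_op_homog (homogM _ _ _ _ h0 k0)) (parity_op_homog (homogM _ _ _ _ h0 k1)).
rewrite (parity_op_homog (homogM _ _ _ _ h1 k0)) (parity_op_homog (homogM _ _ _ _ h1 k1)).
rewrite (parity_op_homog h0) (parity_op_homog h1) (parity_op_homog k0).
rewrite (parity_op_homog k1) /= !expr0 !expr1 !scale1r !scaleN1r.
by rewrite !smulDl !smulDr !smulNl !smulNr opprK.
Qed.

Lemma parity_op1 : parity_op (1%g : A) = 1%g.
Proof. by rewrite (parity_op_homog (@homog1 F A)) scale1r. Qed.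

End SuperAlgebras.

(** * Combinations of words in a set of generators, by length and parity *)

Section Monomials.
Variables (F : fieldType) (W : superAlgType F) (G : W -> Prop).

(** Closed under linear combinations, so that each length and parity gives a subspace. Each letter
    is homogeneous because the Leibniz rule has a sign only for a homogeneous left factor. *)
Inductive mono : nat -> bool -> W -> Prop :=
| mono_one : mono 0 false 1%g
| mono_zero k q : mono k q 0
| mono_lin k q (a : F) x y :
    mono k q x -> mono k q y -> mono k q (a *: x + y)
| mono_mul k p q x w : G x -> homog p x -> mono k q w ->
    mono k.+1 (p (+) q) (x * w)%g.

Lemma mono_homog k q w : mono k q w -> homog q w.
Proof.
elim=> {k q w} [|k q|k q a x y _ hx _ hy|k p q x w _ hx _ hw].
- exact: homog1.
- exact: homog0.
- exact: homogP.
- exact: homogM.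
Qed.

Lemma monoM k q w k' q' w' :
  mono k q w -> mono k' q' w' -> mono (k + k') (q (+) q') (w * w')%g.
Proof.
move=> hw hw'; elim: hw => {k q w} [|k q|k q a x y _ hx _ hy|k p q x w Gx hx _ hw].
- by rewrite mul1g add0n addFb.
- by rewrite smul0l; apply: mono_zero.
- by rewrite super_mulPl; apply: mono_lin.
- by rewrite -mulgA addSn -addbA; apply: mono_mul.
Qed.

Lemma mono_gen p x : G x -> homog p x -> mono 1 p x.
Proof.
move=> Gx hx; rewrite -[x]mulg1 -[p]addbF.
by apply: mono_mul => //; apply: mono_one.
Qed.

Definition spanned (w : W) : Prop := exists n (v : nat -> bool -> W),
  (forall k q, mono k q (v k q)) /\
  w = \sum_(k < n) (v k false + v k true).

Lemma spanned_lin a x y : spanned x -> spanned y -> spanned (a *: x + y).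
Proof.
move=> [n [v [hv ->]]] [m [v' [hv' ->]]].
rewrite (sum_widen (fun k => v k false + v k true) (leq_maxl n m)).
rewrite (sum_widen (fun k => v' k false + v' k true) (leq_maxr n m)).
exists (maxn n m); exists (fun k q => a *: (if (k < n)%N then v k q else 0) +
   (if (k < m)%N then v' k q else 0)); split.
  by move=> k q; apply: mono_lin; case: ifP => _ //; apply: mono_zero.
rewrite scaler_sumr -big_split /=; apply: eq_bigr => i _.
by rewrite addrACA -scalerDr; congr (_ *: _ + _); case: ifP; rewrite // addr0.
Qed.

Lemma spanned0 : spanned 0.
Proof.
exists 0, (fun _ _ => 0); split=> [*|]; first exact: mono_zero.
by rewrite big_ord0.
Qed.

Lemma spanned_mono k q w : mono k q w -> spanned w.
Proof.
move=> hw; exists k.+1.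
exists (fun i r => if (i == k) && (r == q) then w else 0); split.
  by move=> i r; case: ifP => [/andP[/eqP -> /eqP ->] //|_]; apply: mono_zero.
rewrite big_ord_recr /= eqxx big1 => [|i _].
  by case: q hw => _; rewrite /= ?addr0 ?add0r.
by rewrite ltn_eqF // addr0.
Qed.

Lemma spannedD x y : spanned x -> spanned y -> spanned (x + y).
Proof. by move=> hx hy; rewrite -[x]scale1r; apply: spanned_lin. Qed.

Lemma spanned_ind (P : W -> Prop) :
  P 0 -> (forall k q x y, mono k q x -> P y -> P (x + y)) ->
  forall w, spanned w -> P w.
Proof.
move=> P0 PD w [n [v [hv ->]]]; elim: n => [|n IH]; first by rewrite big_ord0.
rewrite big_ord_recr /= [X in P X]addrC -addrA.
by apply: (PD n false) => //; apply: (PD n true).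
Qed.

Lemma spannedM x y : spanned x -> spanned y -> spanned (x * y)%g.
Proof.
move=> hx hy; elim/spanned_ind: hx => [|k q u w hu hw].
  by rewrite smul0l; apply: spanned0.
rewrite smulDl; apply: spannedD hw.
elim/spanned_ind: hy => [|k' q' u' w' hu' hw'].
  by rewrite smul0r; apply: spanned0.
by rewrite smulDr; apply: spannedD hw'; apply: spanned_mono (monoM hu hu').
Qed.

(** Gives the subalgebra of spanned elements its own parity decomposition, which the grading of
    [dual] requires. *)
Lemma spanned_homog w : spanned w -> exists x0 x1,
  [/\ homog false x0 /\ spanned x0, homog true x1 /\ spanned x1 & w = x0 + x1].
Proof.
move=> [n [v [hv ->]]].
exists (\sum_(k < n) v k false), (\sum_(k < n) v k true).
have H q : homog q (\sum_(k < n) v k q) /\ spanned (\sum_(k < n) v k q).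
  split; first by apply: (homog_sum _ (v := v^~ q)) => i; apply: mono_homog (hv _ _).
  apply: big_ind => [||i _]; [exact: spanned0|exact: spannedD|].
  exact: spanned_mono (hv _ _).
by split=> //; rewrite big_split.
Qed.

End Monomials.

(* Pairs stand for [x + e y] with an odd parameter [e] of square zero, so that
   [w |-> (w, D w)] is multiplicative exactly when [D] is an odd derivation;
   restricting the first component to the subalgebra generated by [G] makes the
   same algebra prove that [W] is spanned by monomials. *)
Section OddDualNumbers.
Variables (F : fieldType) (W : superAlgType F) (G : W -> Prop).

Definition dual_pred : pred (W * W)%type := fun p => `[< spanned G p.1 >].

Definition dual := {p : W * W | dual_pred p}.

HB.instance Definition _ := Choice.on dual.
HB.instance Definition _ := SubType.on dual.

Lemma dual_closed : submod_closed dual_pred.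
Proof.
split; first by apply/asboolP; apply: spanned0.
move=> a u v /asboolP hu /asboolP hv; apply/asboolP; exact: spanned_lin.
Qed.

HB.instance Definition _ :=
  GRing.isSubmodClosed.Build F _ dual_pred dual_closed.
HB.instance Definition _ := [SubChoice_isSubLmodule of dual by <:].

Definition dual_mk (x y : W) (h : spanned G x) : dual :=
  exist _ (x, y) (asboolT h).

Lemma dualP (u : dual) : spanned G (val u).1.
Proof. by apply/asboolP; exact: (valP u). Qed.

Lemma dual_inj (u v : dual) :
  (val u).1 = (val v).1 -> (val u).2 = (val v).2 -> u = v.
Proof.
move=> e1 e2; apply: val_inj.
by case: (val u) (val v) e1 e2 => [? ?] [? ?] /= -> ->.
Qed.

Lemma dual_scale1 a (u v : dual) :
  (val (a *: u + v)).1 = a *: (val u).1 + (val v).1.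
Proof. by []. Qed.

Lemma dual_scale2 a (u v : dual) :
  (val (a *: u + v)).2 = a *: (val u).2 + (val v).2.
Proof. by []. Qed.

(** Expands $(x + e y)(x' + e y')$; the involution [parity_op] is the price of moving the odd $e$ to
    the left of $x$. *)
Definition dual_mul (u v : dual) : dual :=
  dual_mk (((val u).2 * (val v).1)%g + (parity_op (val u).1 * (val v).2)%g)
    (spannedM (dualP u) (dualP v)).

Definition dual_one : dual := dual_mk 0 (spanned_mono (mono_one G)).

Lemma dual_mulA : associative dual_mul.
Proof.
move=> u v w; apply: dual_inj; rewrite /= ?mulgA //.
by rewrite !smulDr !smulDl parity_opM !mulgA addrA.
Qed.

Lemma dual_mul1 : left_id dual_one dual_mul.
Proof.
move=> u; apply: dual_inj; rewrite /= ?mul1g //.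
by rewrite smul0l parity_op1 mul1g add0r.
Qed.

Lemma dual_1mul : right_id dual_one dual_mul.
Proof.
move=> u; apply: dual_inj; rewrite /= ?mulg1 //.
by rewrite smul0r addr0.
Qed.

HB.instance Definition _ :=
  isMonoid.Build dual dual_mulA dual_mul1 dual_1mul.

Definition dual_homog (p : bool) (u : dual) : Prop :=
  homog p (val u).1 /\ homog (~~ p) (val u).2.

Lemma dual_homog0 p : dual_homog p 0.
Proof. by split; apply: homog0. Qed.

Lemma dual_homogP p (a : F) (x y : dual) :
  dual_homog p x -> dual_homog p y -> dual_homog p (a *: x + y).
Proof.
by move=> [? ?] [? ?]; split; rewrite ?dual_scale1 ?dual_scale2; apply: homogP.
Qed.

Lemma dual_homog_decomp (x : dual) : exists x0 x1,
  [/\ dual_homog false x0, dual_homog true x1 & x = x0 + x1].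
Proof.
have [x0 [x1 [[h0 s0] [h1 s1] e]]] := spanned_homog (dualP x).
have [y0 [y1 [k0 k1 e']]] := homog_decomp (val x).2.
exists (dual_mk y1 s0), (dual_mk y0 s1); split=> //.
by apply: dual_inj; rewrite raddfD //= e' addrC.
Qed.

Lemma dual_homog_indep (x : dual) :
  dual_homog false x -> dual_homog true x -> x = 0.
Proof.
move=> [a b] [c d].
by apply: dual_inj; apply: homog_indep.
Qed.

HB.instance Definition _ := Lmodule_isSuper.Build F dual
  dual_homog0 dual_homogP dual_homog_decomp dual_homog_indep.

Lemma dual_mulPl (a : F) (x y z : dual) :
  ((a *: x + y)%R * z)%g = a *: (x * z)%g + (y * z)%g.
Proof.
apply: dual_inj; rewrite ?dual_scale1 ?dual_scale2 /=.
  by rewrite super_mulPl.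
rewrite super_mulPl linearP super_mulPl.
by rewrite scalerDr addrACA.
Qed.

Lemma dual_mulPr (a : F) (x y z : dual) :
  (z * (a *: x + y)%R)%g = a *: (z * x)%g + (z * y)%g.
Proof.
apply: dual_inj; rewrite ?dual_scale1 ?dual_scale2 /=.
  by rewrite super_mulPr.
by rewrite !super_mulPr scalerDr addrACA.
Qed.

Lemma dual_homog1 : dual_homog false (1%g : dual).
Proof. by split; [exact: homog1|exact: homog0]. Qed.

Lemma dual_homogM p q (x y : dual) :
  dual_homog p x -> dual_homog q y -> dual_homog (p (+) q) (x * y)%g.
Proof.
move=> [x1 x2] [y1 y2]; split; first exact: homogM.
apply: homogD; first by rewrite -addNb; apply: homogM.
by rewrite -addbN; apply: homogM => //; apply: homog_parity_op.
Qed.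

HB.instance Definition _ := SuperSpace_isSuperAlgebra.Build F dual
  dual_mulPl dual_mulPr dual_homog1 dual_homogM.

Lemma dual_super_commutative :
  super_commutative W -> super_commutative (dual : superAlgType F).
Proof.
move=> comW p q x y [x1 x2] [y1 y2]; apply: dual_inj.
  by rewrite [val (_ *: _)]linearZ /=; exact: comW.
rewrite [val (_ *: _)]linearZ /= (parity_op_homog x1) (parity_op_homog y1).
rewrite !smulZl (comW _ _ _ _ x1 y2) (comW _ _ _ _ x2 y1) addrC scalerDr.
rewrite !scalerA; congr (_ *: _ + _ *: _).
  by case: p q {x1 x2 y1 y2} => -[]; rewrite /= ?expr0 ?expr1 ?mulrNN ?mul1r ?mulr1.
by case: p q {x1 x2 y1 y2} => -[]; rewrite /= ?expr0 ?expr1 ?mulrNN ?mul1r ?mulr1.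
Qed.

End OddDualNumbers.

Section LinearPack.
Variables (F : fieldType) (U V : lmodType F) (f : U -> V) (linf : linear f).
Let f' := f.
HB.instance Definition _ := GRing.isLinear.Build F U V _ f' linf.
(** Bundles a function whose linearity is established only in the course of a proof. *)
Lemma linear_pack : exists h : {linear U -> V}, h =1 f.
Proof. by exists f'. Qed.
End LinearPack.

Definition free_generators (F : fieldType) (V : lmodType F)
  (W : superAlgType F) (s t : V -> W) (x : W) : Prop :=
  exists v, x = s v \/ x = t v.

(** * The Koszul derivation *)

Section Koszul.
Variables (F : fieldType) (V : lmodType F) (W : superAlgType F).
Variables (s t : {linear V -> W}).
Hypothesis freeW : free_super_commutative s t.
Let G := free_generators s t.
Let D : superAlgType F := dual G.

(** The generators are deformed to first order along the derivation sought. The pair over [t v] is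
    even since $e$ and [s v] are both odd. *)
Lemma dual_lift : exists f : {linear W -> D},
  super_alg_hom f /\ (forall v, (val (f (s v))) = (s v, 0) /\
                            (val (f (t v))) = (t v, s v)).
Proof.
have [comW s1 t0 univ] := freeW.
have gs v : spanned G (s v).
  by apply: (spanned_mono (mono_gen _ (s1 v))); exists v; left.
have gt v : spanned G (t v).
  by apply: (spanned_mono (mono_gen _ (t0 v))); exists v; right.
have [|s' s'E] := @linear_pack F V D (fun v => dual_mk 0 (gs v)).
  move=> a x y; apply: dual_inj; rewrite ?dual_scale1 ?dual_scale2 /=.
    by rewrite linearP.
  by rewrite scaler0 addr0.
have [|t' t'E] := @linear_pack F V D (fun v => dual_mk (s v) (gt v)).
  by move=> a x y; apply: dual_inj; rewrite ?dual_scale1 ?dual_scale2 /= linearP.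
have [v|v|f [hf fs ft _]] := univ D s' t' (dual_super_commutative comW).
- by rewrite s'E; split; [exact: s1|exact: homog0].
- by rewrite t'E; split; [exact: t0|exact: s1].
exists f; split=> // v; split.
  by have /= -> := fs v; rewrite s'E.
by have /= -> := ft v; rewrite t'E.
Qed.

(** The first component of the lift is an algebra endomorphism fixing the generators, hence the
    identity by uniqueness. As its values are spanned by construction, so is all of [W], and the
    second component becomes an odd derivation. *)
Lemma koszul_exists : (forall w, spanned G w) /\
  exists K : {linear W -> W},
    [/\ has_parity true K, super_derivation true K,
        forall v, K (s v) = 0 & forall v, K (t v) = s v].
Proof.
have [comW s1 t0 univ] := freeW.
have [f [[fpar f1 fM] fg]] := dual_lift.
have [|p pE] := @linear_pack F W W (fun w => (val (f w)).1).
  by move=> a x y; rewrite linearP dual_scale1.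
have [|K KE] := @linear_pack F W W (fun w => (val (f w)).2).
  by move=> a x y; rewrite linearP dual_scale2.
have [u [_ _ _ uuniq]] := univ W s t comW s1 t0.
have pu : p =1 u.
  apply: uuniq => [|v|v] /=; last 2 first.
  - by rewrite pE (fg v).1.
  - by rewrite pE (fg v).2.
  split=> [q x hx||x y]; rewrite !pE ?f1 ?fM //.
  exact: (fpar _ _ hx).1.
have iu : (idfun : {linear W -> W}) =1 u by apply: uuniq => //; split.
have pid w : p w = w by rewrite pu -iu.
split=> [w|]; first by rewrite -(pid w) pE; apply: dualP.
exists K; split=> [q x hx|q x y hx|v|v]; rewrite !KE.
- exact: (fpar _ _ hx).2.
- rewrite fM /= -!pE !pid (parity_op_homog hx) smulZl.
  by case: q {hx}.
- by rewrite (fg v).1.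
- by rewrite (fg v).2.
Qed.

End Koszul.

(** * Super derivations, their commutators, and their determination by generators *)

Section Derivations.
Variables (F : fieldType) (W : superAlgType F).

Definition is_der (p : bool) (D : W -> W) : Prop :=
  [/\ linear D, has_parity p D & super_derivation p D].

Lemma der1 p D : is_der p D -> D 1%g = 0.
Proof.
move=> [_ _ H]; have := H false 1%g 1%g (@homog1 F W).
rewrite !mul1g mulg1 andbF scale1r => /eqP.
by rewrite -subr_eq0 opprD addrA subrr sub0r oppr_eq0 => /eqP.
Qed.

Lemma super_comm_der p q D D' :
  is_der p D -> is_der q D' -> is_der (p (+) q) (super_comm p q D D').
Proof.
move=> [linD parD derD] [linD' parD' derD'].
have [U UE] := linear_pack linD; have [U' UE'] := linear_pack linD'.
move: parD derD parD' derD' {linD linD'}.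
rewrite -(funext UE) -(funext UE') => parD derD parD' derD' {UE UE' D D'}.
split=> [a x y|r x hx|r x y hx]; rewrite /super_comm.
- by rewrite !linearP addrACA -scalerDr.
- apply: homogB; first by rewrite -addbA; apply/parD/parD'.
  by rewrite addbC addbC -addbA addbCA; apply/homogZ/parD'/parD.
(* [B] and [C] are the mixed terms, with one derivation on each factor; they occur in both orders of
   composition and cancel. [sgn] merges the Koszul signs. *)
- have aux (A A' B C E E' : W) :
    A + B + (C + E) - (A' + C + (B + E')) = A - A' + (E - E').
    rewrite [A + B + _](AC (2*2) ((2*3)*(1*4))) [A' + C + _](AC (2*2) ((3*2)*(1*4))) /=.
    by rewrite opprD [LHS]addrACA subrr add0r opprD [LHS]addrACA.
  have sgn (a b c : bool) u : a (+) b = c ->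
      (-1) ^+ a *: ((-1) ^+ b *: u) = (-1) ^+ c *: u :> W.
    by move=> <-; rewrite scalerA -signr_addb.
  rewrite (derD' _ _ _ hx) (derD _ _ _ hx) !linearD !linearZ /=.
  rewrite (derD _ _ _ hx) (derD' _ _ _ hx).
  rewrite (derD _ _ _ (parD' _ _ hx)) (derD' _ _ _ (parD _ _ hx)).
  rewrite !(smulDl, smulDr, smulNl, smulNr, smulZl, smulZr).
  rewrite !(scalerDr, scalerN).
  rewrite -opprD (sgn (p && r) (q && r) ((p (+) q) && r)); last by rewrite andb_addl.
  rewrite (sgn (q && r) (p && r) ((p (+) q) && r)); last by rewrite addbC andb_addl.
  rewrite (sgn _ (q && (p (+) r)) (q && r)); last by case: (p) (q) (r) => -[] [].
  rewrite (sgn _ (p && r) (p && (q (+) r))); last by rewrite andb_addr.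
  by rewrite aux [X in _ = _ + (_ - X)]scalerA mulrC -scalerA.
Qed.

Lemma zero_der p : is_der p (fun=> 0 : W).
Proof.
split=> [a x y|q x _|q x y _]; rewrite ?scaler0 ?addr0 ?smul0l //.
  exact: homog0.
by rewrite smul0r scaler0 addr0.
Qed.

Lemma der_ext (G : W -> Prop) p D D' : (forall w, spanned G w) ->
  is_der p D -> is_der p D' -> (forall x, G x -> D x = D' x) -> D =1 D'.
Proof.
move=> span hD hD' e w.
have e1 : D 1%g = D' 1%g by rewrite (der1 hD) (der1 hD').
case: hD hD' => linD _ derD [linD' _ derD'].
have [U UE] := linear_pack linD; have [U' UE'] := linear_pack linD'.
move: e e1 derD derD' {linD linD'}.
rewrite -(funext UE) -(funext UE') => e e1 derD derD' {UE UE' D D'}.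
elim/spanned_ind: {w}(span w) => [|k q x y hx hy]; first by rewrite !linear0.
rewrite !linearD hy; congr (_ + _).
elim: hx => {k q x y hy} [|k q|k q a x y _ ex _ ey|k r q x w Gx hx _ ew] //.
- by rewrite !linear0.
- by rewrite !linearP ex ey.
- by rewrite (derD _ _ _ hx) (derD' _ _ _ hx) ew e.
Qed.

Lemma super_comm_ext (G : W -> Prop) p q D D' D'' :
  (forall w, spanned G w) -> is_der p D -> is_der q D' -> is_der (p (+) q) D'' ->
  (forall x, G x -> super_comm p q D D' x = D'' x) ->
  super_comm p q D D' =1 D''.
Proof.
by move=> span hD hD' hD'' e; apply: (der_ext span _ hD'' e); apply: super_comm_der.
Qed.

End Derivations.

(** * Operators with natural numbers as eigenvalues *)

Section Eigenvectors.
Variables (F : fieldType) (E : lmodType F) (N : {linear E -> E}).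
Hypothesis charF : [pchar F] =i pred0.

Definition eigen (k : nat) (w : E) : Prop := N w = k%:R *: w.

Lemma eigen_lin k a x y : eigen k x -> eigen k y -> eigen k (a *: x + y).
Proof. by rewrite /eigen linearP => -> ->; rewrite scalerDr !scalerA mulrC. Qed.

Lemma eigen0 k : eigen k 0.
Proof. by rewrite /eigen linear0 scaler0. Qed.

Lemma eigenD k x y : eigen k x -> eigen k y -> eigen k (x + y).
Proof. by move=> hx hy; rewrite -[x]scale1r; apply: eigen_lin. Qed.

Lemma eigenZ k a x : eigen k x -> eigen k (a *: x).
Proof. by move=> hx; rewrite -[_ *: _]addr0; apply: eigen_lin => //; apply: eigen0. Qed.

Lemma natSf_neq0 k : (k.+1%:R : F) != 0.
Proof. by rewrite ((pcharf0P F).1 charF). Qed.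

(** Applying $N - n$ removes the last vector and rescales the others by $k - n$, nonzero in
    characteristic 0. *)
Lemma eigen_indep n (v : nat -> E) : (forall k, eigen k (v k)) ->
  \sum_(k < n) v k = 0 -> forall k, (k < n)%N -> v k = 0.
Proof.
elim: n v => // n IH v hv.
rewrite big_ord_recr /= => e.
have e' : \sum_(k < n) (k%:R - n%:R : F) *: v k = 0.
  have := congr1 (fun x => N x - n%:R *: x) e.
  rewrite linear0 scaler0 subr0 linearD scalerDr hv opprD addrACA subrr addr0.
  rewrite linear_sum scaler_sumr -sumrB => {2}<-.
  by apply: eq_bigr => i _; rewrite hv scalerBl.
have v0 k : (k < n)%N -> v k = 0.
  move=> kn; have := IH (fun k => (k%:R - n%:R : F) *: v k) _ e' k kn.
  move=> /(_ (fun j => eigenZ _ (hv j))) /eqP.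
  rewrite scaler_eq0 => /orP[|/eqP //].
  rewrite -opprB oppr_eq0 -natrB ?(ltnW kn) // ((pcharf0P F).1 charF).
  by rewrite subn_eq0 leqNgt kn.
move=> k; rewrite ltnS leq_eqVlt => /orP[/eqP ->|]; last exact: v0.
by move: e; rewrite big1 ?add0r // => i _; apply: v0.
Qed.

Hypothesis span : forall w, exists n (v : nat -> E),
  (forall k, eigen k (v k)) /\ w = \sum_(k < n) v k.

(** $N + 1$ multiplies the $k$-th component by $k + 1 \neq 0$. This is what makes degree-lowering
    operators vanish in degree 0. *)
Lemma eigen_neg w : N w = - w -> w = 0.
Proof.
have [n [v [hv ->]]] := span w.
move=> e; have {}e : \sum_(k < n) k.+1%:R *: v k = 0.
  move/eqP: e; rewrite -addr_eq0 linear_sum -big_split => /eqP e.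
  rewrite -[RHS]e.
  by apply: eq_bigr => i _; rewrite hv -natr1 scalerDl scale1r.
rewrite big1 // => i _; apply/eqP.
have := eigen_indep (fun k => eigenZ k.+1%:R (hv k)) e (ltn_ord i) => /eqP.
by rewrite scaler_eq0 (negPf (natSf_neq0 _)).
Qed.

(* Degreewise given linear maps glue because eigenvectors for distinct
   eigenvalues are independent. *)
Lemma eigen_glue (E' : lmodType F) (u : nat -> E -> E') :
  (forall k, linear (u k)) ->
  exists U : {linear E -> E'}, forall k w, eigen k w -> U w = u k w.
Proof.
move=> linu.
have u0 k : u k 0 = 0.
  by have := linu k (-1) 0 0; rewrite !scaleN1r addNr => ->; rewrite addNr.
(* The graph of the map to be built. Being linear, it is single-valued as soon as only 0 lies over
   0, which is independence of eigenvectors. *)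
pose rel w y := exists n (v : nat -> E),
  [/\ forall k, eigen k (v k), w = \sum_(k < n) v k & y = \sum_(k < n) u k (v k)].
have rel_ex w : exists y, rel w y.
  have [n [v [hv e]]] := span w.
  by exists (\sum_(k < n) u k (v k)), n, v.
have rel_lin a w y w' y' : rel w y -> rel w' y' -> rel (a *: w + w') (a *: y + y').
  move=> [n [v [hv -> ->]]] [m [v' [hv' -> ->]]].
  rewrite (sum_widen v (leq_maxl n m)) (sum_widen v' (leq_maxr n m)).
  rewrite (sum_widen (fun k => u k (v k)) (leq_maxl n m)).
  rewrite (sum_widen (fun k => u k (v' k)) (leq_maxr n m)).
  exists (maxn n m), (fun k => a *: (if (k < n)%N then v k else 0) +
     (if (k < m)%N then v' k else 0)); split.
  - by move=> k; apply: eigen_lin; case: ifP => _ //; apply: eigen0.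
  - by rewrite scaler_sumr -big_split.
  - rewrite scaler_sumr -big_split; apply: eq_bigr => i _ /=.
    by rewrite linu; congr (_ *: _ + _); case: ifP.
have rel0 y : rel 0 y -> y = 0.
  move=> [n [v [hv e ->]]]; rewrite big1 // => i _.
  by rewrite (eigen_indep hv (esym e)).
have rel_fun w y y' : rel w y -> rel w y' -> y = y'.
  move=> r r'; have := rel_lin (-1) _ _ _ _ r r'.
  rewrite !scaleN1r addNr => /rel0/eqP.
  by rewrite addrC subr_eq0 => /eqP.
pose f w := projT1 (cid (rel_ex w)).
have fP w : rel w (f w) by rewrite /f; case: cid.
have [|U UE] := @linear_pack F E E' f.
  by move=> a x y; apply: (rel_fun _ _ _ (fP _)); apply: rel_lin.
exists U => k w hw; rewrite UE; apply: (rel_fun _ _ _ (fP _)).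
exists k.+1, (fun i => if i == k then w else 0); split.
- by move=> i; case: eqP => [->|_]; [|apply: eigen0].
- by rewrite big_ord_recr /= eqxx big1 ?add0r // => i _; rewrite ltn_eqF.
- rewrite big_ord_recr /= eqxx big1 ?add0r // => i _.
  by rewrite ltn_eqF.
Qed.

End Eigenvectors.

(** * Dual bases and the canonical element *)

Section DualBases.
Variables (F : fieldType) (g : lieAlgType F).

Definition basis_vec (j : 'I_(\dim {:g})) : g := (vbasis {:g})`_j.
Definition dual_vec (j : 'I_(\dim {:g})) : 'Hom(g, F^o) :=
  linfun (coord (vbasis {:g}) j : g -> F^o).

Lemma dual_basis_vec (xi : g) : \sum_j (dual_vec j xi : F) *: basis_vec j = xi.
Proof.
rewrite [RHS](coord_vbasis (memvf xi)); apply: eq_bigr => j _.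
by rewrite /dual_vec lfunE.
Qed.

Lemma dual_basis_form (mu : 'Hom(g, F^o)) :
  mu = \sum_j (mu (basis_vec j) : F) *: dual_vec j.
Proof.
apply/lfunP => v; rewrite -[in LHS](dual_basis_vec v) linear_sum sum_lfunE.
apply: eq_bigr => j _; rewrite linearZ scale_lfunE /=.
by rewrite [LHS]mulrC.
Qed.

(* Invariance of the canonical element of [g^* (x) g]. *)
Lemma canonical_ad (E : lmodType F) (B : 'Hom(g, F^o) -> g -> E) xi :
  (forall mu, linear (B mu)) -> (forall x, linear (B^~ x)) ->
  \sum_j B (ad_star xi (dual_vec j)) (basis_vec j) =
  \sum_j B (dual_vec j) (lie xi (basis_vec j)).
Proof.
move=> linr linl.
(* Both sides become double sums over the matrix of $\mathrm{ad}_\xi$, differing only in the order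
   of summation. *)
have expl x mu : B mu x = \sum_i (mu (basis_vec i) : F) *: B (dual_vec i) x.
  have [B' BE] := linear_pack (linl x).
  rewrite [in LHS](dual_basis_form mu) -BE linear_sum; apply: eq_bigr => i _.
  by rewrite linearZ /= BE.
have expr x mu : B mu x = \sum_i (dual_vec i x : F) *: B mu (basis_vec i).
  have [B' BE] := linear_pack (linr mu).
  rewrite -[in LHS](dual_basis_vec x) -BE linear_sum; apply: eq_bigr => i _.
  by rewrite linearZ /= BE.
under eq_bigr => j _ do rewrite expl.
rewrite exchange_big; apply: eq_bigr => i _; rewrite [RHS]expr.
by apply: eq_bigr => j _; rewrite ad_starE.
Qed.

End DualBases.

(** * Derivations of the Weil algebra *)

Section WeilDerivations.
Variables (F : fieldType) (g : lieAlgType F) (W : gdAlgType g).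
Variables (s t : {linear 'Hom(g, F^o) -> W}) (K : {linear W -> W}).
Hypothesis span : forall w, spanned (free_generators s t) w.
Hypotheses (ds : forall mu, gd_d (s mu) = t mu)
  (dt : forall mu, gd_d (t mu) = 0).
Hypotheses (Ls : forall xi mu, gd_L xi (s mu) = - s (ad_star xi mu))
  (Lt : forall xi mu, gd_L xi (t mu) = - t (ad_star xi mu)).
Hypotheses (ios : forall xi mu, gd_iota xi (s mu) = (mu xi : F) *: 1%g)
  (iot : forall xi mu, gd_iota xi (t mu) = - s (ad_star xi mu)).
Hypotheses (K_odd : has_parity true K) (K_der : super_derivation true K).
Hypotheses (Ks : forall mu, K (s mu) = 0) (Kt : forall mu, K (t mu) = s mu).

(* The partial derivatives along [xi] in the even and odd generators: they
   kill all generators except [t mu], resp. [s mu], which goes to [mu xi]. *)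
Definition deven (xi : g) (w : W) : W := K (gd_iota xi w) + gd_iota xi (K w).
Definition dodd (xi : g) (w : W) : W := deven xi (gd_d w) - gd_d (deven xi w).

Definition euler (w : W) : W := gd_d (K w) + K (gd_d w).
Definition iota0 (xi : g) (w : W) : W := gd_iota xi w - dodd xi w.

Lemma d_is_der : is_der true (gd_d : W -> W).
Proof. by split; [exact: linearP|exact: gd_d_odd|exact: gd_d_der]. Qed.

Lemma iota_is_der xi : is_der true (gd_iota xi : W -> W).
Proof. by split; [exact: linearP|exact: gd_iota_odd|exact: gd_iota_der]. Qed.

Lemma L_is_der xi : is_der false (gd_L xi : W -> W).
Proof. by split; [exact: linearP|exact: gd_L_even|exact: gd_L_der]. Qed.

Lemma K_is_der : is_der true K.
Proof. by split; [exact: linearP| |]. Qed.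

Lemma scomm_odd D D' (w : W) : super_comm true true D D' w = D (D' w) + D' (D w).
Proof. by rewrite /super_comm expr1 scaleN1r opprK. Qed.

Lemma scomm_even p D D' (w : W) :
  super_comm false p D D' w = D (D' w) - D' (D w).
Proof. by rewrite /super_comm scale1r. Qed.

Lemma scomm_even_r p D D' (w : W) :
  super_comm p false D D' w = D (D' w) - D' (D w).
Proof. by rewrite /super_comm andbF scale1r. Qed.

Lemma eq_is_der p (D D' : W -> W) : D =1 D' -> is_der p D -> is_der p D'.
Proof. by move=> /funext ->. Qed.

Lemma deven_is_der xi : is_der false (deven xi).
Proof.
apply: eq_is_der (super_comm_der K_is_der (iota_is_der xi)) => w.
exact: scomm_odd.
Qed.

Lemma dodd_is_der xi : is_der true (dodd xi).
Proof.
apply: eq_is_der (super_comm_der (deven_is_der xi) d_is_der) => w.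
exact: scomm_even.
Qed.

Lemma euler_is_der : is_der false euler.
Proof.
apply: eq_is_der (super_comm_der d_is_der K_is_der) => w.
exact: scomm_odd.
Qed.

Lemma lin_is_der p (D D' : W -> W) a :
  is_der p D -> is_der p D' -> is_der p (fun w => a *: D w + D' w).
Proof.
move=> [l1 p1 d1] [l2 p2 d2]; split=> [b x y|q x hx|q x y hx].
- by rewrite l1 l2 !scalerDr !scalerA [a * b]mulrC addrACA.
- by apply: homogP; [exact: p1|exact: p2].
- rewrite (d1 _ _ _ hx) (d2 _ _ _ hx) smulDl smulDr smulZl smulZr !scalerDr.
  by rewrite !scalerA [a * _]mulrC addrACA.
Qed.

Lemma opp_is_der p (D : W -> W) : is_der p D -> is_der p (fun w => - D w).
Proof.
move=> hD; apply: eq_is_der (lin_is_der (-1) hD (zero_der W p)) => w.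
by rewrite scaleN1r addr0.
Qed.

Lemma iota0_is_der xi : is_der true (iota0 xi).
Proof.
apply: eq_is_der (lin_is_der (-1) (dodd_is_der xi) (iota_is_der xi)) => w.
by rewrite scaleN1r addrC.
Qed.

HB.instance Definition _ xi :=
  GRing.isLinear.Build F W W _ (deven xi) (let: And3 l _ _ := deven_is_der xi in l).
HB.instance Definition _ xi :=
  GRing.isLinear.Build F W W _ (dodd xi) (let: And3 l _ _ := dodd_is_der xi in l).
HB.instance Definition _ :=
  GRing.isLinear.Build F W W _ euler (let: And3 l _ _ := euler_is_der in l).
HB.instance Definition _ xi :=
  GRing.isLinear.Build F W W _ (iota0 xi) (let: And3 l _ _ := iota0_is_der xi in l).

Lemma deven_s xi mu : deven xi (s mu) = 0.
Proof. by rewrite /deven ios Ks linearZ /= (der1 K_is_der) scaler0 linear0r addr0. Qed.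

Lemma deven_t xi mu : deven xi (t mu) = (mu xi : F) *: 1%g.
Proof. by rewrite /deven iot Kt linearN Ks oppr0 add0r ios. Qed.

Lemma dodd_s xi mu : dodd xi (s mu) = (mu xi : F) *: 1%g.
Proof. by rewrite /dodd ds deven_t deven_s linear0 subr0. Qed.

Lemma dodd_t xi mu : dodd xi (t mu) = 0.
Proof. by rewrite /dodd dt linear0 deven_t linearZ /= (der1 d_is_der) scaler0 subr0. Qed.

Lemma euler_s mu : euler (s mu) = s mu.
Proof. by rewrite /euler ds Ks Kt linear0 add0r. Qed.

Lemma euler_t mu : euler (t mu) = t mu.
Proof. by rewrite /euler dt Kt ds linear0 addr0. Qed.

Lemma iota0_s xi mu : iota0 xi (s mu) = 0.
Proof. by rewrite /iota0 ios dodd_s subrr. Qed.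

Lemma iota0_t xi mu : iota0 xi (t mu) = - s (ad_star xi mu).
Proof. by rewrite /iota0 iot dodd_t subr0. Qed.

Lemma iotaE xi w : gd_iota xi w = iota0 xi w + dodd xi w.
Proof. by rewrite /iota0 subrK. Qed.

Let oneE := (der1 d_is_der, der1 K_is_der, der1 euler_is_der,
  fun xi => der1 (L_is_der xi), fun xi => der1 (iota_is_der xi),
  fun xi => der1 (deven_is_der xi), fun xi => der1 (dodd_is_der xi),
  fun xi => der1 (iota0_is_der xi)).
Let genE := (ds, dt, Ls, Lt, ios, iot, Ks, Kt,
  deven_s, deven_t, dodd_s, dodd_t, euler_s, euler_t, iota0_s, iota0_t).

(** Reduces each relation between derivations of [W] to a look-up in the tables [genE] and
    [oneE]. *)
Lemma comm_ext p q D D' D'' : is_der p D -> is_der q D' ->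
  is_der (p (+) q) D'' ->
  (forall mu, super_comm p q D D' (s mu) = D'' (s mu)) ->
  (forall mu, super_comm p q D D' (t mu) = D'' (t mu)) ->
  super_comm p q D D' =1 D''.
Proof.
move=> hD hD' hD'' es et; apply: (super_comm_ext span hD hD' hD'').
by move=> x [mu [->|->]].
Qed.

Ltac on_generators :=
  rewrite ?scomm_odd ?scomm_even ?scomm_even_r;
  do 4! rewrite ?genE ?linearN ?linearZ ?linear0 /= ?oneE;
  rewrite ?scaler0 ?oppr0 ?addr0 ?subr0 ?add0r ?sub0r ?opprK ?subrr ?addNr ?ad_starE.

Lemma dodd_dodd xi eta w : dodd xi (dodd eta w) = - dodd eta (dodd xi w).
Proof.
apply/eqP; rewrite -addr_eq0 -scomm_odd; apply/eqP.
by apply: (comm_ext (dodd_is_der _) (dodd_is_der _) (zero_der _ _)) => mu;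
  on_generators.
Qed.

Lemma deven_dodd xi eta w : deven xi (dodd eta w) = dodd eta (deven xi w).
Proof.
apply/subr0_eq; rewrite -(scomm_even true).
by apply: (comm_ext (deven_is_der _) (dodd_is_der _) (zero_der _ _)) => mu;
  on_generators.
Qed.

Lemma dodd_d xi w : dodd xi (gd_d w) = - gd_d (dodd xi w).
Proof.
apply/eqP; rewrite -addr_eq0 -scomm_odd; apply/eqP.
by apply: (comm_ext (dodd_is_der _) d_is_der (zero_der _ _)) => mu;
  on_generators.
Qed.

Lemma deven_d xi w : deven xi (gd_d w) = gd_d (deven xi w) + dodd xi w.
Proof. by rewrite /dodd addrC subrK. Qed.

Lemma dodd_L xi eta w :
  dodd eta (gd_L xi w) = gd_L xi (dodd eta w) - dodd (lie xi eta) w.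
Proof.
have <- : super_comm false true (gd_L xi) (dodd eta) w = dodd (lie xi eta) w.
  apply: (comm_ext (L_is_der xi) (dodd_is_der eta) (dodd_is_der (lie xi eta))).
  - by move=> mu; on_generators.
  - by move=> mu; on_generators.
by rewrite scomm_even subKr.
Qed.

Lemma deven_L xi eta w :
  deven eta (gd_L xi w) = gd_L xi (deven eta w) - deven (lie xi eta) w.
Proof.
have <- : super_comm false false (gd_L xi) (deven eta) w = deven (lie xi eta) w.
  apply: (comm_ext (L_is_der xi) (deven_is_der eta) (deven_is_der (lie xi eta))).
  - by move=> mu; on_generators.
  - by move=> mu; on_generators.
by rewrite scomm_even subKr.
Qed.

Lemma dodd_iota xi eta w :
  dodd eta (gd_iota xi w) = - gd_iota xi (dodd eta w) - deven (lie xi eta) w.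
Proof.
have <- : super_comm true true (gd_iota xi) (dodd eta) w = - deven (lie xi eta) w.
  apply: (comm_ext (iota_is_der xi) (dodd_is_der eta)
    (opp_is_der (deven_is_der (lie xi eta)))).
  - by move=> mu; on_generators.
  - by move=> mu; on_generators.
by rewrite scomm_odd addKr.
Qed.

Lemma deven_iota xi eta w : deven eta (gd_iota xi w) = gd_iota xi (deven eta w).
Proof.
apply/subr0_eq; rewrite -(scomm_even true).
by apply: (comm_ext (deven_is_der _) (iota_is_der _) (zero_der _ _)) => mu;
  on_generators.
Qed.

(** Both operators send even generators to odd ones and kill the odd ones, so both compositions
    vanish on generators. For [gd_iota] in place of [iota0] the defect is [deven]. *)
Lemma K_iota0 xi w : K (iota0 xi w) = - iota0 xi (K w).
Proof.
apply/eqP; rewrite -addr_eq0 -scomm_odd; apply/eqP.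
by apply: (comm_ext K_is_der (iota0_is_der _) (zero_der _ _)) => mu;
  on_generators.
Qed.

Lemma K_L xi w : K (gd_L xi w) = gd_L xi (K w).
Proof.
apply/subr0_eq; rewrite -(scomm_even_r true).
by apply: (comm_ext K_is_der (L_is_der _) (zero_der _ _)) => mu;
  on_generators.
Qed.

Lemma euler_comm p D : is_der p D ->
  (forall mu, euler (D (s mu)) = D (s mu)) ->
  (forall mu, euler (D (t mu)) = D (t mu)) ->
  forall w, euler (D w) = D (euler w).
Proof.
move=> hD es et w; apply/subr0_eq; rewrite -(scomm_even p).
by apply: (comm_ext euler_is_der hD (zero_der _ _)) => mu;
  rewrite scomm_even (es, et) genE subrr.
Qed.

Lemma euler_d w : euler (gd_d w) = gd_d (euler w).
Proof. by apply: (euler_comm d_is_der) => mu; on_generators. Qed.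

Lemma euler_K w : euler (K w) = K (euler w).
Proof. by apply: (euler_comm K_is_der) => mu; on_generators. Qed.

Lemma euler_L xi w : euler (gd_L xi w) = gd_L xi (euler w).
Proof. by apply: (euler_comm (L_is_der xi)) => mu; on_generators. Qed.

Lemma euler_iota0 xi w : euler (iota0 xi w) = iota0 xi (euler w).
Proof. by apply: (euler_comm (iota0_is_der xi)) => mu; on_generators. Qed.

Lemma euler_deven xi w : euler (deven xi w) = deven xi (euler w) - deven xi w.
Proof.
have <- : super_comm false false euler (deven xi) w = - deven xi w.
  apply: (comm_ext euler_is_der (deven_is_der xi) (opp_is_der (deven_is_der xi))).
  - by move=> mu; on_generators.
  - by move=> mu; on_generators.
by rewrite scomm_even addrC subrK.
Qed.

Lemma euler_dodd xi w : euler (dodd xi w) = dodd xi (euler w) - dodd xi w.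
Proof.
have <- : super_comm false true euler (dodd xi) w = - dodd xi w.
  apply: (comm_ext euler_is_der (dodd_is_der xi) (opp_is_der (dodd_is_der xi))).
  - by move=> mu; on_generators.
  - by move=> mu; on_generators.
by rewrite scomm_even addrC subrK.
Qed.

(** * The grading of the Weil algebra by number of generators *)

Hypothesis charF : [pchar F] =i pred0.

Notation deg := (eigen euler).

Lemma mono_deg k q w : mono (free_generators s t) k q w -> deg k w.
Proof.
elim=> {k q w} [|k q|k q a x y _ hx _ hy|k p q x w Gx hx _ hw].
- by rewrite /eigen /= oneE scale0r.
- exact: eigen0.
- exact: eigen_lin.
rewrite /eigen /=; case: euler_is_der => _ _ /(_ _ _ w hx) ->.
rewrite scale1r hw smulZr -natr1 scalerDl scale1r addrC; congr (_ + _).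
by case: Gx => mu [] ->; rewrite genE.
Qed.

(** Subtracting from [w] the parity [q] parts of its monomials leaves an element of both parities,
    hence 0. *)
Lemma deg_split q w : homog q w -> exists n (v : nat -> W),
  (forall k, deg k (v k) /\ homog q (v k)) /\ w = \sum_(k < n) v k.
Proof.
move=> hw; have [n [v [hv e]]] := span w.
exists n, (v^~ q); split=> [k|].
  by split; [apply: mono_deg (hv k q)|apply: mono_homog (hv k q)].
have hs r : homog r (\sum_(k < n) v k r).
  by apply: (homog_sum n (v := v^~ r)) => i; apply: mono_homog (hv _ _).
apply/subr0_eq; have e' : w - \sum_(k < n) v k q = \sum_(k < n) v k (~~ q).
  rewrite e -sumrB; apply: eq_bigr => i _.
  by case: (q); rewrite /= ?addrK // addrAC subrr add0r.
have h1 : homog q (w - \sum_(k < n) v k q) by apply: homogB.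
have h2 : homog (~~ q) (w - \sum_(k < n) v k q) by rewrite e'.
by case: (q) h1 h2 => h1 h2; apply: homog_indep.
Qed.

Lemma deg_span w : exists n (v : nat -> W),
  (forall k, deg k (v k)) /\ w = \sum_(k < n) v k.
Proof.
have [n [v [hv e]]] := span w.
exists n, (fun k => v k false + v k true); split=> // k.
by apply: eigenD; apply: mono_deg (hv _ _).
Qed.

Lemma deg_ext (E : lmodType F) (U V : {linear W -> E}) :
  (forall k w, deg k w -> U w = V w) -> U =1 V.
Proof.
move=> e w; have [n [v [hv ->]]] := deg_span w.
by rewrite !linear_sum; apply: eq_bigr => i _; apply: e (hv i).
Qed.

Lemma mono0_unit q w : mono (free_generators s t) 0 q w -> exists c, w = c *: 1%g.
Proof.
move e: 0%N => z h; elim: h e => {z q w} //.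
- by exists 1; rewrite scale1r.
- by exists 0; rewrite scale0r.
move=> k q a x y _ IHx _ IHy /[dup] /IHx [c ->] /IHy [c' ->].
by exists (a * c + c'); rewrite scalerDl scalerA.
Qed.

(** N multiplies the component of length $k$ by $k$, so by independence only length 0 survives. This
    is where agreement on the unit becomes sufficient. *)
Lemma deg0_unit w : deg 0 w -> exists c, w = c *: 1%g.
Proof.
have [n [v [hv ->]]] := span w.
pose u k := v k false + v k true.
have hu k : deg k (u k) by apply: eigenD; apply: mono_deg (hv _ _).
rewrite /eigen /= scale0r linear_sum => e.
have {}e : \sum_(k < n) k%:R *: u k = 0.
  by rewrite -[RHS]e; apply: eq_bigr => i _; rewrite (hu i).
have u0 k : (k.+1 < n)%N -> u k.+1 = 0.
  move=> kn; have := eigen_indep charF (fun k => eigenZ k%:R (hu k)) e kn.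
  by move=> /eqP; rewrite scaler_eq0 (negPf (natSf_neq0 charF _)) => /eqP.
case: n u0 {e} => [|n] u0; first by exists 0; rewrite big_ord0 scale0r.
rewrite big_ord_recl big1 => [|i _]; last exact: (u0 i (ltn_ord i)).
have [c ->] := mono0_unit (hv 0%N false); have [c' ->] := mono0_unit (hv 0%N true).
by exists (c + c'); rewrite addr0 scalerDl.
Qed.

Lemma deg_d k w : deg k w -> deg k (gd_d w).
Proof. by rewrite /eigen /= euler_d => ->; rewrite linearZ. Qed.

Lemma deg_L xi k w : deg k w -> deg k (gd_L xi w).
Proof. by rewrite /eigen /= euler_L => ->; rewrite linearZ. Qed.

Lemma deg_iota0 xi k w : deg k w -> deg k (iota0 xi w).
Proof. by rewrite /eigen /= euler_iota0 => ->; rewrite linearZ. Qed.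

(** In degree 0 the image would have eigenvalue $-1$, so it vanishes and the truncated [k.-1] does
    no harm. *)
Lemma deg_lower (D : {linear W -> W}) k w :
  (forall w, euler (D w) = D (euler w) - D w) ->
  deg k w -> deg k.-1 (D w) /\ (k = 0%N -> D w = 0).
Proof.
move=> eD; case: k => [|k] hw.
  have D0 : D w = 0.
    by apply: (eigen_neg charF deg_span); rewrite /= eD hw scale0r linear0 sub0r.
  by rewrite D0; split=> //; apply: eigen0.
split=> //; rewrite /eigen /= eD hw linearZ /= -natr1 scalerDl scale1r.
by rewrite addrK.
Qed.

Lemma deg_dodd xi k w :
  deg k w -> deg k.-1 (dodd xi w) /\ (k = 0%N -> dodd xi w = 0).
Proof. exact: deg_lower (euler_dodd xi). Qed.

Lemma deg_deven xi k w :
  deg k w -> deg k.-1 (deven xi w) /\ (k = 0%N -> deven xi w = 0).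
Proof. exact: deg_lower (euler_deven xi). Qed.

Lemma deven_linl w : linear (deven^~ w).
Proof.
move=> a x y; rewrite /deven !linearPl linearP /=.
by rewrite addrACA -scalerDr.
Qed.

Lemma dodd_linl w : linear (dodd^~ w).
Proof.
move=> a x y; rewrite /dodd !deven_linl linearP /=.
by rewrite scalerBr opprD addrACA.
Qed.

(** ** Contraction with a connection *)

Variables (A : gdAlgType g) (theta : {linear 'Hom(g, F^o) -> A}).
Hypotheses (theta_odd : forall mu, homog true (theta mu))
  (theta_iota : forall xi mu, gd_iota xi (theta mu) = (mu xi : F) *: 1%g)
  (theta_L : forall xi mu, gd_L xi (theta mu) = - theta (ad_star xi mu)).

Let kappa mu : A := gd_d (theta mu).

Lemma kappa_even mu : homog false (kappa mu).
Proof. exact: gd_d_odd (theta_odd mu). Qed.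

Lemma d_thetaM mu a :
  gd_d (theta mu * a)%g = (kappa mu * a)%g - (theta mu * gd_d a)%g.
Proof. by rewrite (gd_d_der _ _ _ (theta_odd mu)) expr1 scaleN1r. Qed.

Lemma d_kappaM mu a : gd_d (kappa mu * a)%g = (kappa mu * gd_d a)%g.
Proof.
by rewrite (gd_d_der _ _ _ (kappa_even mu)) gd_dd smul0l add0r scale1r.
Qed.

Lemma iota_thetaM xi mu a : gd_iota xi (theta mu * a)%g =
  (mu xi : F) *: a - (theta mu * gd_iota xi a)%g.
Proof.
by rewrite (gd_iota_der _ _ _ _ (theta_odd mu)) theta_iota smulZl mul1g expr1 scaleN1r.
Qed.

Lemma d1A : gd_d (1%g : A) = 0.
Proof.
by apply: (@der1 F A true gd_d); split;
  [exact: linearP|exact: gd_d_odd|exact: gd_d_der].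
Qed.

Lemma iota_kappa xi mu : gd_iota xi (kappa mu) = - theta (ad_star xi mu).
Proof.
have := gd_d_iota xi (theta mu); rewrite /super_comm expr1 scaleN1r opprK.
by rewrite theta_iota linearZ /= d1A scaler0 add0r theta_L.
Qed.

Lemma iota_kappaM xi mu a : gd_iota xi (kappa mu * a)%g =
  - (theta (ad_star xi mu) * a)%g + (kappa mu * gd_iota xi a)%g.
Proof.
by rewrite (gd_iota_der _ _ _ _ (kappa_even mu)) iota_kappa smulNl scale1r.
Qed.

Lemma L_thetaM xi mu a : gd_L xi (theta mu * a)%g =
  - (theta (ad_star xi mu) * a)%g + (theta mu * gd_L xi a)%g.
Proof. by rewrite (gd_L_der _ _ _ _ (theta_odd mu)) theta_L smulNl scale1r. Qed.

Lemma L_kappaM xi mu a : gd_L xi (kappa mu * a)%g =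
  - (kappa (ad_star xi mu) * a)%g + (kappa mu * gd_L xi a)%g.
Proof.
rewrite (gd_L_der _ _ _ _ (kappa_even mu)) scale1r; congr (_ + _).
have /subr0_eq : gd_d (gd_L xi (theta mu)) - gd_L xi (kappa mu) = 0.
  by rewrite -[RHS](gd_d_L xi (theta mu)) /super_comm andbF scale1r.
by rewrite theta_L linearN /= => <-; rewrite smulNl.
Qed.

(** [mu] and [xi] are kept independent so that bilinearity can be stated and [canonical_ad] applied.
    The sign comes from moving the odd [dodd xi] past [u]. *)
Definition cterm (p : bool) (u : W -> A) mu xi w : A :=
  (-1) ^+ p *: (theta mu * u (dodd xi w))%g + (kappa mu * u (deven xi w))%g.

(* The action of the canonical element [sum_j x_j^* (x) x_j] on linear maps of
   parity [p], through multiplication by the connection and its differential on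
   the target and through partial derivatives on the source. *)
Definition contract (p : bool) (u : W -> A) w : A :=
  \sum_j cterm p u (dual_vec j) (basis_vec j) w.

Lemma cterm_lin p u mu xi : linear u -> linear (cterm p u mu xi).
Proof.
move=> lu a x y; rewrite /cterm [dodd _ _]linearP [deven _ _]linearP !lu !super_mulPr.
by rewrite !scalerDr !scalerA [a * _]mulrC addrACA.
Qed.

Lemma cterm_linr p u mu w : linear u -> linear (fun xi => cterm p u mu xi w).
Proof.
move=> lu a x y; rewrite /cterm deven_linl dodd_linl !lu !super_mulPr.
by rewrite !scalerDr !scalerA [a * _]mulrC addrACA.
Qed.

Lemma cterm_linl p u xi w : linear (fun mu => cterm p u mu xi w).
Proof.
move=> a x y; rewrite /cterm /kappa [theta _]linearP [gd_d _]linearP !super_mulPl.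
by rewrite !scalerDr !scalerA [a * _]mulrC addrACA.
Qed.

Lemma contract_lin p u : linear u -> linear (contract p u).
Proof.
move=> lu a x y; rewrite /contract scaler_sumr -big_split.
by apply: eq_bigr => j _; apply: cterm_lin.
Qed.

(** The term in which d turns [theta mu] into [kappa mu] cancels the extra [dodd] from [deven_d].
    This ties the two halves of [cterm] together. *)
Lemma cterm_d p (u : {linear W -> A}) mu xi w :
  gd_d (cterm p u mu xi w) - (-1) ^+ p *: cterm p u mu xi (gd_d w) =
  cterm (~~ p) (fun v => gd_d (u v) - (-1) ^+ p *: u (gd_d v)) mu xi w.
Proof.
rewrite /cterm dodd_d deven_d; move: (dodd xi w) (deven xi w) => a b.
rewrite [gd_d (_ + _)]linearD [gd_d (_ *: _)]linearZ /=.
rewrite d_thetaM d_kappaM [u (- _)]linearN [u (_ + _)]linearD.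
rewrite !(smulDl, smulDr, smulNl, smulNr, smulZl, smulZr).
case: p; rewrite /= ?expr0 ?expr1 ?scale1r ?scaleN1r ?opprD ?opprK !addrA.
  by rewrite [LHS](ACl ((1*6)*((2*4)*(3*5)))) /= addNr add0r addrA.
by rewrite [LHS](ACl ((1*6)*((2*4)*(3*5)))) /= subrr add0r addrA.
Qed.

Lemma cterm_L p (u : {linear W -> A}) eta mu xi w :
  gd_L eta (cterm p u mu xi w) - cterm p u mu xi (gd_L eta w) =
  cterm p (fun v => gd_L eta (u v) - u (gd_L eta v)) mu xi w -
  (cterm p u (ad_star eta mu) xi w - cterm p u mu (lie eta xi) w).
Proof.
rewrite /cterm dodd_L deven_L.
move: (dodd xi w) (deven xi w) (dodd (lie _ _) w) (deven (lie _ _) w) => a b a' b'.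
rewrite linearDr linearZr_LR /= L_thetaM L_kappaM.
rewrite ![u (_ - _)]linearB.
rewrite !(smulDl, smulDr, smulNl, smulNr, smulZl, smulZr).
rewrite ?(scalerDr, scalerN, opprD, opprK) !addrA.
by rewrite [LHS](ACl (2*5*4*7*1*3*6*8)).
Qed.

(** [iota] of [theta mu] yields the term with [mu eta], which survives summation. The last bracket
    joins the coadjoint term of [iota_kappaM] to the [deven] defect of [dodd_iota]; summed over dual
    bases, it vanishes by invariance. *)
Lemma cterm_iota p (u : {linear W -> A}) eta mu xi w :
  gd_iota eta (cterm p u mu xi w) - (-1) ^+ p *: cterm p u mu xi (gd_iota eta w) =
  cterm (~~ p) (fun v => gd_iota eta (u v) - (-1) ^+ p *: u (gd_iota eta v)) mu xi w
  + (-1) ^+ p *: ((mu eta : F) *: u (dodd xi w)) -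
  ((theta (ad_star eta mu) * u (deven xi w))%g -
   (theta mu * u (deven (lie eta xi) w))%g).
Proof.
rewrite /cterm dodd_iota deven_iota.
move: (dodd xi w) (deven xi w) (deven (lie _ _) w) => a b b'.
rewrite linearDr linearZr_LR /= iota_thetaM iota_kappaM.
rewrite [u (_ - _)]linearB [u (- _)]linearN.
rewrite !(smulDl, smulDr, smulNl, smulNr, smulZl, smulZr).
case: p; rewrite /= ?expr0 ?expr1 ?scale1r ?scaleN1r ?opprD ?opprK !addrA.
  by rewrite [LHS](ACl (2*5*4*7*1*3*6)).
by rewrite [LHS](ACl (2*5*4*7*1*3*6)).
Qed.

Lemma cterm_dodd p (u : {linear W -> A}) eta mu xi w :
  cterm (~~ p) (fun v => (-1) ^+ p *: u (dodd eta v)) mu xi w =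
  (-1) ^+ p *: cterm p u mu xi (dodd eta w).
Proof.
rewrite /cterm dodd_dodd deven_dodd linearN !smulZr smulNr scalerDr.
by case: p; rewrite /= ?expr0 ?expr1 ?scale1r ?scaleN1r ?scalerN ?opprK.
Qed.

Lemma contract_d p (u : {linear W -> A}) w :
  gd_d (contract p u w) - (-1) ^+ p *: contract p u (gd_d w) =
  contract (~~ p) (fun v => gd_d (u v) - (-1) ^+ p *: u (gd_d v)) w.
Proof.
rewrite /contract linear_sum scaler_sumr -sumrB.
by apply: eq_bigr => j _; apply: cterm_d.
Qed.

Lemma contract_L p (u : {linear W -> A}) eta w :
  gd_L eta (contract p u w) - contract p u (gd_L eta w) =
  contract p (fun v => gd_L eta (u v) - u (gd_L eta v)) w.
Proof.
rewrite /contract linear_sumr -sumrB.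
under eq_bigr => j _ do rewrite cterm_L.
rewrite sumrB sumrB (canonical_ad (B := fun mu xi => cterm p u mu xi w)).
- by rewrite subrr subr0.
- by move=> mu; apply/cterm_linr/linearP.
- by move=> x; apply: cterm_linl.
Qed.

Lemma contract_dodd p (u : {linear W -> A}) eta w :
  contract (~~ p) (fun v => (-1) ^+ p *: u (dodd eta v)) w =
  (-1) ^+ p *: contract p u (dodd eta w).
Proof.
rewrite /contract scaler_sumr.
by apply: eq_bigr => j _; apply: cterm_dodd.
Qed.

Lemma contract_add p (u v : W -> A) w :
  contract p (fun x => u x + v x) w = contract p u w + contract p v w.
Proof.
rewrite /contract -big_split; apply: eq_bigr => j _.
by rewrite /cterm !smulDr scalerDr addrACA.
Qed.

Lemma contract_iota p (u : {linear W -> A}) eta w :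
  gd_iota eta (contract p u w) - (-1) ^+ p *: contract p u (gd_iota eta w) =
  contract (~~ p) (fun v => gd_iota eta (u v) - (-1) ^+ p *: u (gd_iota eta v)) w
  + (-1) ^+ p *: u (dodd eta w).
Proof.
rewrite /contract linear_sumr scaler_sumr -sumrB.
under eq_bigr => j _ do rewrite cterm_iota.
rewrite sumrB sumrB big_split /=.
rewrite (canonical_ad (B := fun mu xi => theta mu * u (deven xi w))%g).
- rewrite subrr subr0 -scaler_sumr; congr (_ + _ *: _).
  (* The surviving terms recombine to [dodd eta] because $\sum_j e^j(\eta) e_j = \eta$. *)
  rewrite -[in RHS](dual_basis_vec eta).
  have [D DE] := linear_pack (dodd_linl w).
  rewrite -DE !linear_sum; apply: eq_bigr => j _.
  by rewrite !linearZ /= DE.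
- by move=> mu a x y; rewrite deven_linl linearP super_mulPr.
- by move=> x a mu nu; rewrite linearP super_mulPl.
Qed.

(** Trading [gd_iota] for [iota0] on the source adds composition with [dodd], which commutes with
    the contraction; the correction term is therefore unchanged. *)
Lemma contract_iota0 p (u : {linear W -> A}) eta w :
  gd_iota eta (contract p u w) - (-1) ^+ p *: contract p u (iota0 eta w) =
  contract (~~ p) (fun v => gd_iota eta (u v) - (-1) ^+ p *: u (iota0 eta v)) w
  + (-1) ^+ p *: u (dodd eta w).
Proof.
have [C CE] := linear_pack (contract_lin p (u := u) (linearP u)).
have e (B : {linear W -> A}) v : (-1) ^+ p *: B (iota0 eta v) =
    (-1) ^+ p *: B (gd_iota eta v) - (-1) ^+ p *: B (dodd eta v).
  by rewrite -scalerBr -linearB.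
have -> : (fun v => gd_iota eta (u v) - (-1) ^+ p *: u (iota0 eta v)) =
  (fun v => (gd_iota eta (u v) - (-1) ^+ p *: u (gd_iota eta v)) +
     (-1) ^+ p *: u (dodd eta v)).
  by apply: funext => v; rewrite e opprB addrA addrAC.
rewrite contract_add contract_dodd -!CE e opprB addrA addrAC !CE contract_iota.
by rewrite addrAC.
Qed.

Lemma contract_parity p (u : W -> A) : has_parity p u -> has_parity p (contract p u).
Proof.
move=> hu q w hw; rewrite /contract.
apply: big_ind => [||j _]; [exact: homog0|exact: homogD|].
case: (dodd_is_der (basis_vec j)) (deven_is_der (basis_vec j)) => _ ho _ [_ he _].
apply: homogD.
  apply: homogZ; have := homogM _ _ _ _ (theta_odd (dual_vec j)) (hu _ _ (ho _ _ hw)).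
  by rewrite [true (+) _]addTb addbCA addTb negbK.
exact: homogM _ _ _ _ (kappa_even (dual_vec j)) (hu _ _ (he _ _ hw)).
Qed.

Lemma iter_contract_lin p u a : linear u -> linear (iter a (contract p) u).
Proof. by move=> lu; elim: a => //= a; apply: contract_lin. Qed.

(** Each contraction lowers the degree of the argument by one, and in degree 0 both partial
    derivatives vanish. *)
Lemma iter_contract_nil p u a k w :
  linear u -> deg k w -> (k < a)%N -> iter a (contract p) u w = 0.
Proof.
move=> lu; elim: a k w => // a IH k w hw ka /=.
have [U UE] := linear_pack (iter_contract_lin p a lu).
rewrite /contract big1 // => j _; rewrite /cterm.
have [ho ho0] := deg_dodd (basis_vec j) hw.
have [he he0] := deg_deven (basis_vec j) hw.
have [k0|k0] := eqVneq k 0%N.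
  by rewrite ho0 // he0 // -UE linear0 !smul0r scaler0 addr0.
have ka' : (k.-1 < a)%N by rewrite prednK // lt0n.
by rewrite !(IH k.-1) // !smul0r scaler0 addr0.
Qed.

(** ** Exponentials of the contraction *)

(** [U] is $\exp(c\,\mathrm{Th})u$, specified degree by degree. Every truncation beyond the degree
    is allowed, so that sums for different degrees can be given a common length. *)
Definition is_exp p (c : F) (u : W -> A) (U : W -> A) : Prop :=
  forall k n w, deg k w -> (k < n)%N ->
    U w = \sum_(a < n) (c ^+ a / a`!%:R) *: iter a (contract p) u w.

Lemma exp_exists p c u : linear u -> exists U : {linear W -> A}, is_exp p c u U.
Proof.
move=> lu.
pose v k w := \sum_(a < k.+1) (c ^+ a / a`!%:R) *: iter a (contract p) u w.
have [|U UE] := eigen_glue charF deg_span (u := v).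
  move=> k b x y; rewrite /v scaler_sumr -big_split; apply: eq_bigr => a _.
  by rewrite (iter_contract_lin p a lu) /= scalerDr !scalerA [b * _]mulrC.
exists U => k n w hw kn; rewrite (UE _ _ hw); apply/esym.
apply: (sum_trunc (v := fun a => (c ^+ a / a`!%:R) *: iter a (contract p) u w)) => // a ka.
by rewrite (iter_contract_nil p lu hw ka) scaler0.
Qed.

Lemma exp_coefS (c : F) a : (c ^+ a.+1 / a.+1`!%:R) * a.+1%:R = c * (c ^+ a / a`!%:R).
Proof.
rewrite factS natrM invfM exprS !mulrA mulrAC; congr (_ * _).
by rewrite mulfVK ?(natSf_neq0 charF).
Qed.

Lemma contract_sum p n (b : nat -> F) (f : nat -> W -> A) :
  contract p (fun w => \sum_(i < n) b i *: f i w) =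
  fun w => \sum_(i < n) b i *: contract p (f i) w.
Proof.
apply: funext => w; rewrite /contract; under [RHS]eq_bigr => i _ do rewrite scaler_sumr.
rewrite [RHS]exchange_big; apply: eq_bigr => j _.
rewrite /cterm !smul_sumr scaler_sumr -big_split; apply: eq_bigr => i _ /=.
by rewrite !smulZr scalerDr !scalerA [b i * _]mulrC.
Qed.

Lemma contract_eq_deg p k (u v : W -> A) w :
  (forall x, deg k.-1 x -> u x = v x) -> deg k w -> contract p u w = contract p v w.
Proof.
move=> e hw; apply: eq_bigr => j _; rewrite /cterm !e //.
  by have [] := deg_deven (basis_vec j) hw.
by have [] := deg_dodd (basis_vec j) hw.
Qed.

(** The series is available only on eigenvectors; induction works since a contraction in degree [k]
    evaluates its map in degree [k.-1], still below [n]. *)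
Lemma iter_contract_exp p c u (U : {linear W -> A}) : linear u -> is_exp p c u U ->
  forall a k n w, deg k w -> (k < n)%N ->
  iter a (contract p) U w =
  \sum_(b < n) (c ^+ b / b`!%:R) *: iter (a + b) (contract p) u w.
Proof.
move=> lu hU a k n; elim: a k => [|a IH] k w hw kn; first exact: hU hw kn.
under eq_bigr => b _ do rewrite addSn iterS.
pose v w := \sum_(b < n) (c ^+ b / b`!%:R) *: iter (a + b) (contract p) u w.
transitivity (contract p v w); last first.
  have := congr1 (@^~ w) (contract_sum p n (fun b => c ^+ b / b`!%:R)
    (fun b => iter (a + b) (contract p) u)).
  exact.
rewrite iterS; apply: contract_eq_deg hw.
by move=> x hx; apply: IH hx _; apply: leq_ltn_trans kn; apply: leq_pred.
Qed.

(** Cauchy product: the coefficient of $\mathrm{Th}^m$ is $(1 - 1)^m / m!$. *)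
Lemma exp_expN p (u : {linear W -> A}) (U V : {linear W -> A}) :
  is_exp p (-1) u U -> is_exp p 1 U V -> V =1 u.
Proof.
move=> hU hV; apply: deg_ext => k w hw.
rewrite (hV _ k.+1 _ hw) //.
pose h m := iter m (contract p) u w.
have h0 m : (k < m)%N -> h m = 0 by apply: iter_contract_nil hw; exact: linearP.
pose cf (c : F) a := c ^+ a / a`!%:R.
(* Indexed by the total power [m]; powers above [k] vanish on [w], so both series stop at the same
   place. *)
have step a : (a < k.+1)%N -> iter a (contract p) U w =
    \sum_(m < k.+1 | (a <= m)%N) cf (-1) (m - a)%N *: h m.
  move=> ak; rewrite (iter_contract_exp (linearP u) hU a hw (ltnSn k)).
  rewrite (sum_trunc (m := k.+1 - a) (v := fun b => cf (-1) b *: h (a + b)%N)).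
  - rewrite -(big_mkord (fun m => a <= m)%N (fun m => cf (-1) (m - a)%N *: h m)).
    rewrite (big_cat_nat (n := a)) //=; last exact: ltnW.
    rewrite [X in _ = X + _]big_nat_cond [X in _ = X + _]big1 ?add0r => [|m]; last first.
      by move=> /andP[/andP[_ ma]]; rewrite leqNgt ma.
    have := big_addn 0 k.+1 a (leq a) (fun i => cf (-1) (i - a)%N *: h i).
    rewrite add0n => -> ; rewrite big_mkord.
    apply: eq_big => [b|b _]; first by rewrite leq_addl.
    by rewrite addnK addnC.
  - exact: leq_subr.
  - by move=> b; rewrite leq_subLR => /h0 ->; rewrite scaler0.
have -> : \sum_(a < k.+1) (1 ^+ a / a`!%:R) *: iter a (contract p) U w =
  \sum_(m < k.+1) (\sum_(a < m.+1) cf 1 a * cf (-1) (m - a)%N) *: h m.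
  under eq_bigr => a _ do rewrite step // scaler_sumr big_mkcond.
  rewrite exchange_big; apply: eq_bigr => m _ /=.
  rewrite (big_ord_widen _ (fun a => cf 1 a * cf (-1) (m - a)%N) (ltn_ord m)).
  rewrite scaler_suml [RHS]big_mkcond; apply: eq_bigr => a _.
  by rewrite ltnS; case: ifP => // _; rewrite scalerA.
rewrite big_ord_recl [X in _ + X]big1 => [|i _].
  rewrite addr0 big_ord_recl big_ord0 addr0 /cf subn0 !expr0 fact0.
  by rewrite !mulr1n divr1 mul1r scale1r.
rewrite (_ : \sum_(a < _) _ = 0) ?scale0r //.
set m := lift _ _; have m0 : (m : nat) != 0%N by [].
have : ((-1 : F) + 1) ^+ m = 0 by rewrite addNr expr0n (negPf m0).
rewrite exprDn => /(congr1 (fun x => m`!%:R^-1 * x)); rewrite mulr0 => e.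
rewrite -[RHS]e.
rewrite mulr_sumr; apply: eq_bigr => a _.
rewrite /cf !expr1n mulr1 div1r -[_ *+ 'C(_, _)]mulr_natr.
have am : (a <= m)%N by rewrite -ltnS.
have := congr1 (fun x => x%:R : F) (bin_fact am); rewrite !natrM => <-.
have Cneq0 : ('C(m, a)%:R : F) != 0 by rewrite ((pcharf0P F).1 charF) -lt0n bin_gt0.
by rewrite !invfM [RHS]mulrC -mulrA mulVKf // mulrCA.
Qed.

(** * Commutators with the exponential *)

Section ExpCommutation.
Variables (p p' : bool) (sg : F) (XA : {linear A -> A}) (XW : {linear W -> W}).
Variable J : (W -> A) -> W -> A.
(** Covers d, L, iota, and the mixed pair of [gd_iota] on [A] with [iota0] on [W]. [J] is the
    commutator of [X] with the contraction. [XW_deg] admits a part of lower degree because [gd_iota]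
    is the sum of [iota0] and the degree-lowering [dodd]. *)
Let X (u : W -> A) (w : W) : A := XA (u w) - sg *: u (XW w).
Hypothesis XW_deg : forall k w, deg k w ->
  exists x y j, [/\ XW w = x + y, deg k x, deg j y & (j <= k)%N].
Hypothesis XC : forall (u : {linear W -> A}),
  X (contract p u) = fun w => contract p' (X u) w + J u w.
Hypothesis JC : forall (u : {linear W -> A}),
  J (contract p u) = contract p' (J u).
Hypothesis J_lin : forall u, linear u -> linear (J u).

Let X_lin u : linear u -> linear (X u).
Proof.
move=> lu a x y; rewrite /X [XW _]linearP !lu [XA _]linearP scalerDr scalerBr !scalerA.
by rewrite [sg * a]mulrC opprD addrACA.
Qed.

(** $[X, \mathrm{Th}^a] = a\,\mathrm{Th}^{a-1} J$ because [J] commutes with Th. For [a = 0] the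
    truncated exponent is masked by the coefficient 0. *)
Lemma iter_contract_comm (u : {linear W -> A}) a w :
  X (iter a (contract p) u) w =
  iter a (contract p') (X u) w + a%:R *: iter a.-1 (contract p') (J u) w.
Proof.
elim: a w => [|a IH] w; first by rewrite scale0r addr0.
have [v vE] := linear_pack (iter_contract_lin p a (linearP u)).
have JE : J v = iter a (contract p') (J u).
  rewrite (funext vE); elim: a {v vE IH} => //= a IHa.
  have [v vE] := linear_pack (iter_contract_lin p a (linearP u)).
  by rewrite -IHa -(funext vE) JC.
rewrite iterS -(funext vE) XC JE (funext vE) (funext IH).
rewrite contract_add iterS -addrA; congr (_ + _).
rewrite -natr1 scalerDl scale1r /=; congr (_ + _).
case: a {IH v vE JE} => [|a].
  rewrite !scale0r /contract big1 // => j _.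
  by rewrite /cterm !scale0r !smul0r scaler0 addr0.
rewrite [iter a.+1 _ _]iterS /contract scaler_sumr; apply: eq_bigr => j _.
by rewrite /cterm !smulZr scalerDr !scalerA [_ * a.+1%:R]mulrC.
Qed.

(* As [J] commutes with the contraction, [X exp = exp (X + c J)]. *)
Lemma exp_comm c (u U V : {linear W -> A}) : is_exp p c u U ->
  is_exp p' c (fun w => X u w + c *: J u w) V -> X U =1 V.
Proof.
move=> hU hV.
have [XU XUE] := linear_pack (X_lin (linearP U)).
suff : XU =1 V by move=> e w; rewrite -e XUE.
apply: deg_ext => k w hw; rewrite XUE.
have [x [y [j [e hx hy jk]]]] := XW_deg hw.
(* One term more than degree [k] demands: the factor [a] shifts the [J] series by one index, and the
   unmatched last term on the right is zero by nilpotence. *)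
have k2 : (k < k.+2)%N by rewrite ltnW.
have eXW : U (XW w) =
    \sum_(a < k.+2) (c ^+ a / a`!%:R) *: iter a (contract p) u (XW w).
  rewrite e linearD (hU _ _ _ hx k2) (hU _ _ _ hy (leq_ltn_trans jk k2)).
  rewrite -big_split; apply: eq_bigr => a _.
  have [v /funext <-] := linear_pack (iter_contract_lin p a (linearP u)).
  by rewrite linearD scalerDr.
rewrite (hV _ _ _ hw k2) {1}/X eXW (hU _ _ _ hw k2) linear_sum scaler_sumr -sumrB.
have stepX (a : 'I_k.+2) : XA ((c ^+ a / a`!%:R) *: iter a (contract p) u w) -
    sg *: ((c ^+ a / a`!%:R) *: iter a (contract p) u (XW w)) =
    (c ^+ a / a`!%:R) *: iter a (contract p') (X u) w +
    (c ^+ a / a`!%:R * a%:R) *: iter a.-1 (contract p') (J u) w.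
  move: (c ^+ a / a`!%:R) => z.
  rewrite [XA (_ *: _)]linearZ /= [sg *: _]scalerA [sg * _]mulrC -!scalerA -scalerBr.
  by rewrite -[XA _ - _]/(X _ w) iter_contract_comm scalerDr.
under eq_bigr => a _ do rewrite stepX.
have iterD (v v' : W -> A) b a x' : iter a (contract p') (fun w => v w + b *: v' w) x' =
    iter a (contract p') v x' + b *: iter a (contract p') v' x'.
  elim: a x' => //= a IHa x'; rewrite (funext IHa) contract_add; congr (_ + _).
  rewrite /contract scaler_sumr; apply: eq_bigr => i _.
  by rewrite /cterm !smulZr scalerDr !scalerA [b * _]mulrC.
under [RHS]eq_bigr => a _ do rewrite iterD scalerDr.
rewrite !big_split; congr (_ + _) => /=.
rewrite big_ord_recl mulr0 scale0r add0r [RHS]big_ord_recr -[nat_of_ord ord_max]/k.+1.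
rewrite (iter_contract_nil p' (J_lin (linearP u)) hw (ltnSn k)) !scaler0 [RHS]addr0.
apply: eq_bigr => a _; rewrite /= /bump add1n exp_coefS.
by rewrite scalerA mulrC.
Qed.

End ExpCommutation.

Lemma is_exp_eq p c u v U : u =1 v -> is_exp p c u U -> is_exp p c v U.
Proof. by move=> /funext ->. Qed.

Lemma is_exp_zero p c (U : {linear W -> A}) : is_exp p c (fun=> 0) U -> forall w, U w = 0.
Proof.
move=> hU.
have l0 : linear (fun _ : W => 0 : A) by move=> a x y; rewrite addr0 scaler0.
have [O OE] := linear_pack l0.
move=> w; rewrite -[RHS](OE w); move: w; apply: deg_ext => k w hw.
rewrite (hU _ _ _ hw (ltnSn k)) big1 ?OE // => a _.
suff -> : iter a (contract p) (fun=> 0) w = 0 by rewrite scaler0.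
elim: (nat_of_ord a) {hw} w => //= b IH w; rewrite /contract big1 // => j _.
by rewrite /cterm !IH !smul0r scaler0 addr0.
Qed.

Lemma exp_one p c u (U : {linear W -> A}) : is_exp p c u U -> U 1%g = u 1%g.
Proof.
move=> hU; have h1 : deg 0 (1%g : W) by rewrite /eigen /= oneE scale0r.
by rewrite (hU _ 1%N _ h1) // big_ord1 fact0 divr1 scale1r.
Qed.

Lemma exp_parity p c (u : {linear W -> A}) (U : {linear W -> A}) :
  has_parity p u -> is_exp p c u U -> has_parity p U.
Proof.
move=> hu hU q w /deg_split [n [v [hv ->]]]; rewrite linear_sum.
apply: big_ind => [||i _]; [exact: homog0|exact: homogD|].
have [hd hq] := hv i; rewrite (hU _ _ _ hd (ltnSn i)).
apply: big_ind => [||a _]; [exact: homog0|exact: homogD|].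
have ha : has_parity p (iter a (contract p) u).
  by elim: (nat_of_ord a) => //= b; apply: contract_parity.
by apply: homogZ; apply: ha.
Qed.

Lemma deg_refl_split (D : W -> W) : (forall k w, deg k w -> deg k (D w)) ->
  forall k w, deg k w ->
  exists x y j, [/\ D w = x + y, deg k x, deg j y & (j <= k)%N].
Proof.
move=> hD k w hw; exists (D w), 0, k; split=> //; last exact: eigen0.
  by rewrite addr0.
exact: hD.
Qed.

Lemma deg_iota_split xi k w : deg k w ->
  exists x y j, [/\ gd_iota xi w = x + y, deg k x, deg j y & (j <= k)%N].
Proof.
move=> hw; exists (iota0 xi w), (dodd xi w), k.-1; split.
- exact: iotaE.
- exact: deg_iota0.
- by case: (deg_dodd xi hw).
- exact: leq_pred.
Qed.

Lemma exp_d p c (u U V : {linear W -> A}) : is_exp p c u U ->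
  is_exp (~~ p) c (fun w => gd_d (u w) - (-1) ^+ p *: u (gd_d w)) V ->
  forall w, gd_d (U w) - (-1) ^+ p *: U (gd_d w) = V w.
Proof.
move=> hU hV w.
apply: (exp_comm (p := p) (p' := ~~ p) (sg := (-1) ^+ p) (XA := gd_d)
  (XW := gd_d) (J := fun _ _ => 0) _ _ _ _ hU) => //.
- exact: deg_refl_split deg_d.
- by move=> v; apply: funext => x; rewrite addr0 contract_d.
- move=> v; apply: funext => x; rewrite /contract big1 // => j _.
  by rewrite /cterm !smul0r scaler0 addr0.
- by move=> v _ a x y; rewrite scaler0 addr0.
- by apply: is_exp_eq hV => x; rewrite scaler0 addr0.
Qed.

Lemma exp_L p c eta (u U V : {linear W -> A}) : is_exp p c u U ->
  is_exp p c (fun w => gd_L eta (u w) - u (gd_L eta w)) V ->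
  forall w, gd_L eta (U w) - U (gd_L eta w) = V w.
Proof.
move=> hU hV w; rewrite -[U (gd_L _ _)]scale1r.
apply: (exp_comm (p := p) (p' := p) (sg := 1) (XA := gd_L eta)
  (XW := gd_L eta) (J := fun _ _ => 0) _ _ _ _ hU) => //.
- exact: deg_refl_split (deg_L eta).
- move=> v; apply: funext => x; rewrite addr0 scale1r contract_L.
  by congr contract; apply: funext => y; rewrite scale1r.
- move=> v; apply: funext => x; rewrite /contract big1 // => j _.
  by rewrite /cterm !smul0r scaler0 addr0.
- by move=> v _ a x y; rewrite scaler0 addr0.
- by apply: is_exp_eq hV => x; rewrite scaler0 addr0 scale1r.
Qed.

Lemma dodd_comp_lin p eta (u : W -> A) : linear u ->
  linear (fun w => (-1) ^+ p *: u (dodd eta w)).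
Proof.
move=> lu a x y; rewrite [dodd _ _]linearP lu scalerDr !scalerA.
by rewrite [a * _]mulrC.
Qed.

Lemma exp_iota p c eta (u U V : {linear W -> A}) : is_exp p c u U ->
  is_exp (~~ p) c (fun w => gd_iota eta (u w) - (-1) ^+ p *: u (gd_iota eta w) +
    c *: ((-1) ^+ p *: u (dodd eta w))) V ->
  forall w, gd_iota eta (U w) - (-1) ^+ p *: U (gd_iota eta w) = V w.
Proof.
move=> hU hV w.
apply: (exp_comm (p := p) (p' := ~~ p) (sg := (-1) ^+ p) (XA := gd_iota eta)
  (XW := gd_iota eta) (J := fun u w => (-1) ^+ p *: u (dodd eta w)) _ _ _ _ hU) => //.
- exact: deg_iota_split.
- by move=> v; apply: funext => x; rewrite contract_iota.
- by move=> v; apply: funext => x; rewrite contract_dodd.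
- exact: dodd_comp_lin.
Qed.

Lemma exp_iota0 p c eta (u U V : {linear W -> A}) : is_exp p c u U ->
  is_exp (~~ p) c (fun w => gd_iota eta (u w) - (-1) ^+ p *: u (iota0 eta w) +
    c *: ((-1) ^+ p *: u (dodd eta w))) V ->
  forall w, gd_iota eta (U w) - (-1) ^+ p *: U (iota0 eta w) = V w.
Proof.
move=> hU hV w.
apply: (exp_comm (p := p) (p' := ~~ p) (sg := (-1) ^+ p) (XA := gd_iota eta)
  (XW := iota0 eta) (J := fun u w => (-1) ^+ p *: u (dodd eta w)) _ _ _ _ hU) => //.
- exact: deg_refl_split (deg_iota0 eta).
- by move=> v; apply: funext => x; rewrite contract_iota0.
- by move=> v; apply: funext => x; rewrite contract_dodd.
- exact: dodd_comp_lin.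
Qed.

(** Used with [exp_d], [exp_L], [exp_iota] and [exp_iota0]: when the corrected commutator of [u]
    vanishes, so does the commutator of its exponential. *)
Lemma exp_zero p c (u : W -> A) : (forall w, u w = 0) ->
  exists V : {linear W -> A}, is_exp p c u V /\ forall w, V w = 0.
Proof.
move=> /(@funext _ _ u (fun=> 0)) ->.
have [|V hV] := @exp_exists p c (fun=> 0).
  by move=> a x y; rewrite addr0 scaler0.
by exists V; split=> //; apply: is_exp_zero hV.
Qed.

(** * Construction of the homotopy *)

Lemma euler_homotopy (f : {linear W -> A}) :
  has_parity false f -> f 1%g = 0 -> (forall w, f (gd_d w) = gd_d (f w)) ->
  (forall xi w, f (iota0 xi w) = gd_iota xi (f w)) ->
  (forall xi w, f (gd_L xi w) = gd_L xi (f w)) ->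
  exists h : {linear W -> A},
  [/\ has_parity true h,
      forall w, gd_d (h w) + h (gd_d w) = f w,
      forall xi w, gd_iota xi (h w) + h (iota0 xi w) = 0
    & forall xi w, gd_L xi (h w) = h (gd_L xi w)].
Proof.
move=> f0 f1 fd fi fL.
(* In degree 0 the convention [0^-1 = 0] makes [h] zero. *)
have [|h hE] := eigen_glue charF deg_span (u := fun k w => k%:R^-1 *: f (K w)).
  by move=> k a x y; rewrite [K _]linearP [f _]linearP scalerDr !scalerA [a * _]mulrC.
exists h; split.
- move=> q w /deg_split [n [v [hv ->]]]; rewrite linear_sum.
  apply: big_ind => [||i _]; [exact: homog0|exact: homogD|].
  have [hd hq] := hv i; rewrite (hE _ _ hd); apply: homogZ.
  exact: (f0 _ _ (K_odd hq)).
- move=> w; have [n [v [hv ->]]] := deg_span w.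
  rewrite !linear_sum -big_split; apply: eq_bigr => i _ /=.
  rewrite (hE _ _ (hv i)) (hE _ _ (deg_d (hv i))) linearZ /= -scalerDr -fd -linearD.
  rewrite -/(euler (v i)) (hv i) linearZ scalerA /=.
  (* In degree 0 the left side is 0, and so is the right: the component is a multiple of the
     unit. *)
  have [i0|i0] := eqVneq (i : nat) 0%N; last first.
    by rewrite mulVf ?scale1r // ((pcharf0P F).1 charF).
  have [|c ->] := @deg0_unit (v i); first by rewrite -i0; apply: hv.
  by rewrite linearZ /= f1 !scaler0.
- move=> xi w; have [n [v [hv ->]]] := deg_span w.
  rewrite !linear_sum -big_split big1 // => i _ /=.
  rewrite (hE _ _ (hv i)) (hE _ _ (deg_iota0 xi (hv i))) linearZ /= -scalerDr.
  by rewrite K_iota0 linearN fi subrr scaler0.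
- move=> xi w; have [n [v [hv ->]]] := deg_span w.
  rewrite !linear_sum; apply: eq_bigr => i _ /=.
  rewrite (hE _ _ (hv i)) (hE _ _ (deg_L xi (hv i))) linearZ /=.
  by rewrite K_L fL.
Qed.

Lemma homotopy_exists (f : {linear W -> A}) :
  has_parity false f -> f 1%g = 0 -> (forall w, f (gd_d w) = gd_d (f w)) ->
  (forall xi w, f (gd_iota xi w) = gd_iota xi (f w)) ->
  (forall xi w, f (gd_L xi w) = gd_L xi (f w)) ->
  exists h : {linear W -> A},
  [/\ has_parity true h,
      forall w, gd_d (h w) + h (gd_d w) = f w,
      forall xi w, gd_iota xi (h w) + h (gd_iota xi w) = 0
    & forall xi w, gd_L xi (h w) = h (gd_L xi w)].
Proof.
move=> fpar f1 fd fi fL.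
have [f0 hf0] := exp_exists false (-1) (linearP f).
have f0_par := exp_parity fpar hf0.
have f01 : f0 1%g = 0 by rewrite (exp_one hf0).
have f0d w : f0 (gd_d w) = gd_d (f0 w).
  have [|V [hV V0]] := @exp_zero (~~ false) (-1)
    (fun w => gd_d (f w) - (-1) ^+ false *: f (gd_d w)).
    by move=> x; rewrite fd scale1r subrr.
  by have /eqP := exp_d hf0 hV w; rewrite V0 scale1r subr_eq0 => /eqP.
have f0L xi w : f0 (gd_L xi w) = gd_L xi (f0 w).
  have [|V [hV V0]] := @exp_zero false (-1)
    (fun w => gd_L xi (f w) - f (gd_L xi w)).
    by move=> x; rewrite fL subrr.
  by have /eqP := exp_L hf0 hV w; rewrite V0 subr_eq0 => /eqP.
(* The constant $-1$ makes the correction subtract [f] of [dodd], completing [iota0] to [gd_iota],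
   with which [f] commutes. *)
have f0i xi w : f0 (iota0 xi w) = gd_iota xi (f0 w).
  have [|V [hV V0]] := @exp_zero (~~ false) (-1)
    (fun w => gd_iota xi (f w) - (-1) ^+ false *: f (iota0 xi w)
      + (-1) *: ((-1) ^+ false *: f (dodd xi w))).
    move=> x; rewrite !scale1r scaleN1r -addrA -opprD -linearD -iotaE fi.
    by rewrite subrr.
  by have /eqP := exp_iota0 hf0 hV w; rewrite V0 scale1r subr_eq0 => /eqP.
have [h0 [h0_par h0d h0i h0L]] := euler_homotopy f0_par f01 f0d f0i f0L.
have [h hh] := exp_exists true 1 (linearP h0).
exists h; split.
- exact: exp_parity h0_par hh.
(* [V] is read in two ways: as the exponential of [f0] it equals [f], and as that of $d h_0 + h_0 d$
   it equals $d h + h d$. *)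
- have [V hV] := exp_exists false 1 (linearP f0).
  move=> w; rewrite -(exp_expN hf0 hV w).
  have hV' : is_exp (~~ true) 1
      (fun w => gd_d (h0 w) - (-1) ^+ true *: h0 (gd_d w)) V.
    by apply: is_exp_eq hV => x; rewrite scaleN1r opprK h0d.
  by have := exp_d hh hV' w; rewrite scaleN1r opprK.
- move=> xi w.
  have [|V [hV V0]] := @exp_zero (~~ true) 1
    (fun w => gd_iota xi (h0 w) - (-1) ^+ true *: h0 (gd_iota xi w)
      + 1 *: ((-1) ^+ true *: h0 (dodd xi w))).
    move=> x; rewrite scale1r !scaleN1r opprK iotaE linearD addrA addrK.
    exact: h0i.
  by have := exp_iota hh hV w; rewrite V0 scaleN1r opprK.
- move=> xi w.
  have [|V [hV V0]] := @exp_zero true 1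
    (fun w => gd_L xi (h0 w) - h0 (gd_L xi w)).
    by move=> x; rewrite h0L subrr.
  by have /eqP := exp_L hh hV w; rewrite V0 subr_eq0 => /eqP.
Qed.

End WeilDerivations.

Theorem theorem3p2 (F : fieldType) (charF : [pchar F] =i pred0)
    (g : lieAlgType F) (W A : gdAlgType g) (weilW : weil_algebra W)
    (freeA : locally_free A) (c0 c1 : {linear W -> A})
    (hom0 : gd_hom c0) (hom1 : gd_hom c1) (unit01 : c0 1%g = c1 1%g) :
  gd_homotopic c0 c1.
Proof.
have [s [t [freeW [ds dt] [Ls Lt] [ios iot]]]] := weilW.
have [theta [theta_odd theta_iota theta_L]] := freeA.
have [span [K [K_odd K_der Ks Kt]]] := koszul_exists freeW.
have [par0 d0 iota0 L0] := hom0; have [par1 d1 iota1 L1] := hom1.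
have [f fE] := linear_pack (linearP (c0 \- c1)).
have [|||xi w|xi w|h [h_odd hd hi hL]] := homotopy_exists span ds dt Ls Lt ios iot
  K_odd K_der Ks Kt charF theta_odd theta_iota theta_L (f := f).
- by move=> q x hx; rewrite fE /=; apply: homogB; [exact: par0|exact: par1].
- by rewrite fE /= unit01 subrr.
- by move=> w; rewrite !fE /= d0 d1 linearB.
- by rewrite !fE /= iota0 iota1 linearB.
- by rewrite !fE /= L0 L1 linearB.
by exists h; split=> // x; rewrite hd fE.
Qed.
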